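(* Let $\Lambda'\subset\mathbb{Z}$ be a Sidon set and let $\mu$ be a measure on $\mathbb{T}$. Then for every $\varepsilon>0$ there is an $\varepsilon$-almost singular measure $\nu$ on $\mathbb{T}$ with $\|\nu\|\le\|\mu\|+\varepsilon$ and $\widehat{\nu}(\gamma)=\widehat{\mu}(\gamma)$ for all $\gamma\in\Lambda'$.
   Context: Measures on the circle group $\mathbb{T}$ are finite complex Borel measures, $\|\cdot\|$ is the total variation norm, $|\nu|$ is the variation measure of $\nu$, $\widehat{\mu}(\gamma)$ ($\gamma\in\mathbb{Z}$) are the Fourier(-Stieltjes) coefficients, and $\lambda$ is normalised Lebesgue (Haar) measure on $\mathbb{T}$. A measure $\nu$ is $\varepsilon$-almost singular if there is a (Borel) set $S\subset\mathbb{T}$ with $\lambda(S)\le\varepsilon$ and $|\nu|(\mathbb{T}\setminus S)\le\varepsilon$. A set $\Lambda'\subset\mathbb{Z}$ is a Sidon set if every function in $C_{\Lambda'}$, the space of continuous functions on $\mathbb{T}$ whose Fourier coefficients vanish off $\Lambda'$, has a Fourier series that converges absolutely with respect to the sup-norm (i.e. $\sum_{n}|\widehat f(n)|<\infty$). *)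

(* Defs.v *)
From HB Require Import structures.
From mathcomp Require Import all_boot all_order all_algebra.
From mathcomp Require Import complex.
From mathcomp Require Import all_classical all_reals all_analysis measurable_realfun.

Set Warnings "-redundant-canonical-projection".

Set Implicit Arguments.
Unset Strict Implicit.
Unset Printing Implicit Defensive.

Import Order.TTheory GRing.Theory Num.Theory.
Import numFieldNormedType.Exports.

Local Open Scope classical_set_scope.
Local Open Scope ring_scope.
Local Open Scope complex_scope.

(* The topology of R[i] is the one of its modulus. *)
HB.instance Definition _ (R : rcfType) := NormedModule.copy R[i] R[i]^o.

Section complex_continuity.
Context {R : realType}.
Implicit Types z : R[i].

Lemma norm_normc z : `|z| = (Normc.normc z)%:C.
Proof. by case: z. Qed.

Lemma normc_Re z : `|complex.Re z| <= Normc.normc z.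
Proof. by have := normc_ge_Re z; rewrite norm_normc lecR. Qed.

Lemma normc_Im z : `|complex.Im z| <= Normc.normc z.
Proof.
case: z => a b /=; rewrite -sqrtr_sqr ler_wsqrtr// lerDr sqr_ge0//.
Qed.

Lemma ReD : {morph @complex.Re R : z w / z + w}.
Proof. by case=> a b [c d]. Qed.

Lemma ImD : {morph @complex.Im R : z w / z + w}.
Proof. by case=> a b [c d]. Qed.

Lemma ReB z w : complex.Re (z - w) = complex.Re z - complex.Re w.
Proof. by case: z; case: w. Qed.

Lemma ImB z w : complex.Im (z - w) = complex.Im z - complex.Im w.
Proof. by case: z; case: w. Qed.

Lemma continuous_Re : continuous (@complex.Re R : R[i] -> R).
Proof.
move=> z P [e /= e0 eP].
apply/nbhs_ballP; exists (e%:C : R[i]) => /=; first by rewrite ltcR.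
move=> w; rewrite /ball/= => zw; apply: eP; rewrite /ball_/=.
by move: zw; rewrite norm_normc ltcR; apply: le_lt_trans; rewrite -ReB normc_Re.
Qed.

Lemma continuous_Im : continuous (@complex.Im R : R[i] -> R).
Proof.
move=> z P [e /= e0 eP].
apply/nbhs_ballP; exists (e%:C : R[i]) => /=; first by rewrite ltcR.
move=> w; rewrite /ball/= => zw; apply: eP; rewrite /ball_/=.
by move: zw; rewrite norm_normc ltcR; apply: le_lt_trans; rewrite -ImB normc_Im.
Qed.

Lemma continuous_Complex (T : topologicalType) (f g : T -> R) :
  continuous f -> continuous g -> continuous (fun x => f x +i* g x : R[i]).
Proof.
move=> cf cg x; apply/cvgrPdist_lt => -[e e'] e0.
have {e' e0} [e0 ->] : 0 < e /\ e' = 0.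
  by move: e0; rewrite ltcE /= => /andP[/eqP <-].
near=> y; rewrite -/(e%:C) norm_normc ltcR /=.
have fe : `|f x - f y| < e / 2.
  by near: y; apply: cvgr_dist_lt; [exact: cf|rewrite divr_gt0].
have ge : `|g x - g y| < e / 2.
  by near: y; apply: cvgr_dist_lt; [exact: cg|rewrite divr_gt0].
rewrite [ltRHS]splitr (le_lt_trans _ (ltrD fe ge))//.
rewrite -[leRHS]ger0_norm ?addr_ge0// -sqrtr_sqr ler_wsqrtr//.
rewrite -(real_normK (num_real (f x - f y))).
rewrite -(real_normK (num_real (g x - g y))) sqrrD.
by rewrite lerD2r lerDl mulrn_wge0// mulr_ge0.
Unshelve. all: by end_near. Qed.

End complex_continuity.

Definition circle (R : realType) : Type := set_type [set z : R[i] | `|z| = 1].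

Section circle.
Context {R : realType}.

Lemma norm_circle_exp (t : R) :
  `|cos (2 * pi * t) +i* sin (2 * pi * t) : R[i]| = 1.
Proof. by rewrite norm_normc /= cos2Dsin2 sqrtr1. Qed.

(* e^(2 i pi t) *)
Definition circle_exp (t : R) : circle R :=
  exist _ (cos (2 * pi * t) +i* sin (2 * pi * t)) (mem_set (norm_circle_exp t)).

HB.instance Definition _ := Topological.copy (circle R)
  (set_type [set z : R[i] | `|z| = 1]).
HB.instance Definition _ := isPointed.Build (circle R) (circle_exp 0).

(* The measurable sets of the circle are the Borel sets. *)
HB.instance Definition _ := @isMeasurable.Build
  (sigma_display (@open (circle R))) (circle R) <<s @open (circle R) >>
  (@sigma_algebra0 _ setT _) (@sigma_algebraC _ _)
  (@sigma_algebra_bigcup _ setT _).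

Lemma continuous_circle_exp : continuous circle_exp.
Proof.
apply/continuousP => _ [B oB <-].
rewrite -comp_preimage; move: B oB; apply/continuousP.
apply: continuous_Complex => t.
- by apply: continuous_comp; [exact: mulrl_continuous|exact: continuous_cos].
- by apply: continuous_comp; [exact: mulrl_continuous|exact: continuous_sin].
Qed.

Lemma measurable_circle_exp : measurable_fun [set: R] circle_exp.
Proof.
apply: (@measurability _ _ _ _ _ _ (@open (circle R))) => //.
move=> _ [B oB <-]; rewrite setTI.
by apply: open_measurable; move/continuousP : continuous_circle_exp; exact.
Qed.

HB.instance Definition _ :=
  isMeasurableFun.Build _ _ _ _ circle_exp measurable_circle_exp.

End circle.

(* Normalised Haar measure: the image of Lebesgue measure on [0, 1] under
   t |-> e^(2 i pi t). *)
Definition haar (R : realType) (S : set (circle R)) : \bar R :=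
  lebesgue_measure (circle_exp @^-1` S `&` `[0, 1]).

Section haar.
Context {R : realType}.

Let measurable_haar (S : set (circle R)) : measurable S ->
  measurable (circle_exp @^-1` S `&` `[0, 1] : set R).
Proof.
move=> mS; apply: measurableI => //.
by rewrite -[X in measurable X]setTI; exact: measurable_circle_exp.
Qed.

Let haar0 : @haar R set0 = 0%E.
Proof. by rewrite /haar preimage_set0 set0I measure0. Qed.

Let haar_ge0 (S : set (circle R)) : (0 <= haar S)%E.
Proof. exact: measure_ge0. Qed.

Let haar_sigma_additive : semi_sigma_additive (@haar R).
Proof.
move=> F mF tF mUF; rewrite /haar preimage_bigcup setI_bigcupl.
apply: measure_semi_sigma_additive.
- by move=> n; exact: measurable_haar.
- apply/trivIsetP => /= i j _ _ ij; rewrite setIACA -preimage_setI.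
  by move/trivIsetP : tF => /(_ _ _ _ _ ij) ->//; rewrite preimage_set0 set0I.
- by rewrite -setI_bigcupl -preimage_bigcup; exact: measurable_haar.
Qed.

HB.instance Definition _ := isMeasure.Build _ _ _ (@haar R)
  haar0 haar_ge0 haar_sigma_additive.

Lemma haar_setT : @haar R setT = 1%E.
Proof.
by rewrite /haar preimage_setT setTI lebesgue_measure_itv /=
  lte_fin ltr01 oppr0 adde0.
Qed.

HB.instance Definition _ := Measure_isProbability.Build _ _ _ (@haar R) haar_setT.
End haar.

(* A complex measure is a charge with values in R[i]; only the measurable sets
   are relevant, and there its values are finite. *)
Section complex_measure.
Context d (T : measurableType d) (R : realType).
Implicit Type nu : {charge set T -> \bar R[i]}.

Definition charge_Re nu (A : set T) : \bar R := (complex.Re (fine (nu A)))%:E.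
Definition charge_Im nu (A : set T) : \bar R := (complex.Im (fine (nu A)))%:E.

Let part_semi_sigma_additive (p : R[i] -> R) nu :
  {morph p : z w / z + w} -> p 0 = 0 -> continuous p ->
  semi_sigma_additive (fun A => (p (fine (nu A)))%:E).
Proof.
move=> pD p0 cp F mF tF mUF.
have fnu A : measurable A -> nu A = (fine (nu A))%:E.
  by move=> mA; rewrite fineK// fin_num_measure.
have sumE n : (\sum_(0 <= i < n) (p (fine (nu (F i))))%:E)%E =
    (p (fine (\sum_(0 <= i < n) nu (F i))%E))%:E.
  elim: n => [|n ih]; first by rewrite !big_geq//= p0.
  rewrite !big_nat_recr//= ih -EFinD -pD; congr (p _)%:E.
  rewrite fineD//; last exact: fin_num_measure.
  by rewrite sum_fin_num; apply/allP => x /mapP[i _ ->]; exact: fin_num_measure.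
under eq_fun do rewrite sumE.
have := @charge_semi_sigma_additive _ _ _ nu F mF tF mUF.
rewrite {1}(fnu _ mUF) => h.
have pfine : (p (fine x))%:E @[x --> (fine (nu (\bigcup_n F n)))%:E] -->
    (p (fine (nu (\bigcup_n F n))))%:E.
  by move=> P /= hP; have := cp _ _ hP.
exact: (cvg_comp _ _ h pfine).
Qed.

Section parts.
Variable nu : {charge set T -> \bar R[i]}.

Let charge_Re0 : charge_Re nu set0 = 0%E.
Proof. by rewrite /charge_Re charge0. Qed.

Let charge_Im0 : charge_Im nu set0 = 0%E.
Proof. by rewrite /charge_Im charge0. Qed.

HB.instance Definition _ := isCharge.Build _ _ _ (charge_Re nu)
  charge_Re0 (fun _ _ => isT)
  (part_semi_sigma_additive ReD erefl continuous_Re).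

HB.instance Definition _ := isCharge.Build _ _ _ (charge_Im nu)
  charge_Im0 (fun _ _ => isT)
  (part_semi_sigma_additive ImD erefl continuous_Im).

End parts.

(* |nu|(A) is the supremum over the countable measurable partitions of A. *)
Definition variation_measure nu (A : set T) : \bar R :=
  ereal_sup [set (\sum_(0 <= i <oo) (Normc.normc (fine (nu (F i))))%:E)%E
            | F in [set F : (set T)^nat | [/\ forall i, measurable (F i),
                      trivIset setT F & \bigcup_i F i = A]]].

(* The Hahn decomposition is unique up to null sets, so the choice made here
   does not affect the integral. *)
Definition charge_Rintegral (sigma : {charge set T -> \bar R}) (g : T -> R) : R :=
  let sigmaPN := projT2 (cid (projT2 (cid (Hahn_decomposition sigma)))) in
  \int[jordan_pos sigmaPN]_x g x - \int[jordan_neg sigmaPN]_x g x.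

Definition charge_Cintegral nu (f : T -> R[i]) : R[i] :=
  let u x := complex.Re (f x) in let v x := complex.Im (f x) in
  (charge_Rintegral (charge_Re nu) u - charge_Rintegral (charge_Im nu) v) +i*
  (charge_Rintegral (charge_Re nu) v + charge_Rintegral (charge_Im nu) u).

Definition Cintegral (m : {measure set T -> \bar R}) (f : T -> R[i]) : R[i] :=
  (\int[m]_x complex.Re (f x)) +i* (\int[m]_x complex.Im (f x)).

End complex_measure.

(* z ^ (- n) is the inverse, hence the conjugate, of the character z ^ n. *)
Section fourier.
Context {R : realType}.

Definition fourier_coef (f : circle R -> R[i]) (n : int) : R[i] :=
  Cintegral (@haar R) (fun z => f z * set_val z ^ (- n)).

Definition fourier_stieltjes (nu : {charge set (circle R) -> \bar R[i]})
    (n : int) : R[i] :=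
  charge_Cintegral nu (fun z => set_val z ^ (- n)).

End fourier.

Definition sidon (R : realType) (L : set int) : Prop :=
  forall f : circle R -> R[i], continuous f ->
    (forall n, ~ L n -> fourier_coef f n = 0) ->
    (\esum_(n in [set: int]) (Normc.normc (fourier_coef f n))%:E < +oo)%E.

Definition almost_singular (R : realType) (e : R)
    (nu : {charge set (circle R) -> \bar R[i]}) : Prop :=
  exists S : set (circle R), [/\ measurable S, (haar S <= e%:E)%E &
    (variation_measure nu (~` S) <= e%:E)%E].

(* Main.v *)
(* nu is sought in the form mu + g * haar, with g a trigonometric polynomial whose
   Fourier coefficients vanish on L.  Off a set S of small Haar measure, mu has a
   density f, which is approximated in L^1 by a trigonometric polynomial p.
   Multiplying p by a finite Riesz product K (a nonnegative trigonometric
   polynomial with mean 1, all of whose other coefficients are tiny, and whose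
   mass sits on a small set because the integral of sqrt K is tiny) does not
   increase its L^1 norm much, and changes its Fourier coefficients by a uniformly
   small amount.  As L is a Sidon set, the change (K - 1) p agrees on L with a
   trigonometric polynomial r of small L^1 norm: otherwise a separating functional
   would be a polynomial with spectrum in L contradicting the Sidon inequality
   sum |fhat| <= C sup |f|.  Take g = (K - 1) p - r. *)
Require Import Defs.
From HB Require Import structures.
From mathcomp Require Import all_boot all_order all_algebra.
From mathcomp Require Import complex.
From mathcomp Require Import all_classical all_reals all_analysis.
From mathcomp Require Import measurable_realfun.
From mathcomp Require Import ring lra zify.
From Stdlib Require Import Lia.

Import Order.TTheory GRing.Theory Num.Theory.
Import numFieldNormedType.Exports.

Set Implicit Arguments.
Unset Strict Implicit.
Unset Printing Implicit Defensive.

Local Open Scope classical_set_scope.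
Local Open Scope ring_scope.
Local Open Scope complex_scope.

Local Notation Re := complex.Re.
Local Notation Im := complex.Im.
Local Notation nc := Normc.normc.

(** * Complex-valued integrals *)

Section complex_basics.
Context {R : realType}.
Implicit Types z w : R[i].

(** The correction r is only as small as the Fourier coefficients it has to cancel, whereas an
    almost singular density is far from small. A Riesz product reconciles the two: its coefficients
    are governed by [delta], its concentration by the number of factors. Hence the order of the
    choices: p, then the sum W of the moduli of its coefficients, then [delta] in terms of W and the
    Sidon constant, and last the number of factors. Since p is a polynomial, W is finite, and it
    bounds the coefficients of (K - 1) p by delta * W. The small integral of sqrt K is used twice.
    Where K > 1 also sqrt K > 1, so this set has small measure; elsewhere K <= sqrt K, so K p has
    little mass there. The part of mu on S is left untouched, because S joins the exceptional set.
    The kernel |z + w|^(2M) also serves twice: as an approximate identity it gives the density of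
    polynomials in L^1, and in the separation argument it is the test element that turns a linear
    functional into the value of a polynomial at a point. *)

Lemma normc_ge0 z : 0 <= nc z.
Proof. by case: z => a b /=; exact: sqrtr_ge0. Qed.

Lemma normc_real (a : R) : nc a%:C = `|a|.
Proof. by rewrite /= expr0n /= addr0 sqrtr_sqr. Qed.

Lemma normc_le_abs z : nc z <= `|Re z| + `|Im z|.
Proof.
case: z => a b /=.
rewrite -[leRHS]ger0_norm ?addr_ge0// -sqrtr_sqr ler_wsqrtr//.
rewrite -(real_normK (num_real a)) -(real_normK (num_real b)) sqrrD.
by rewrite lerD2r lerDl mulrn_wge0// mulr_ge0.
Qed.

Lemma normc_sqr z : nc z ^+ 2 = Re z ^+ 2 + Im z ^+ 2.
Proof. by case: z => a b /=; rewrite sqr_sqrtr// addr_ge0// sqr_ge0. Qed.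

Lemma ReM z w : Re (z * w) = Re z * Re w - Im z * Im w.
Proof. by case: z; case: w. Qed.

Lemma ImM z w : Im (z * w) = Re z * Im w + Im z * Re w.
Proof. by case: z => a b; case: w => c d /=. Qed.

Lemma ReMr (a : R) z : Re (a%:C * z) = a * Re z.
Proof. by rewrite ReM /= mul0r subr0. Qed.

Lemma ImMr (a : R) z : Im (a%:C * z) = a * Im z.
Proof. by rewrite ImM /= mul0r addr0. Qed.

Lemma complex_ext z w : Re z = Re w -> Im z = Im w -> z = w.
Proof. by case: z => a b; case: w => c d /= -> ->. Qed.

Lemma Re_sum (I : Type) (s : seq I) (P : pred I) (F : I -> R[i]) :
  Re (\sum_(i <- s | P i) F i) = \sum_(i <- s | P i) Re (F i).
Proof. by rewrite (big_morph _ (@ReD R) (erefl : Re 0 = 0)). Qed.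

Lemma Im_sum (I : Type) (s : seq I) (P : pred I) (F : I -> R[i]) :
  Im (\sum_(i <- s | P i) F i) = \sum_(i <- s | P i) Im (F i).
Proof. by rewrite (big_morph _ (@ImD R) (erefl : Im 0 = 0)). Qed.

Lemma normc_sum (I : Type) (s : seq I) (P : pred I) (F : I -> R[i]) :
  nc (\sum_(i <- s | P i) F i) <= \sum_(i <- s | P i) nc (F i).
Proof.
elim/big_rec2: _ => [|i y x _ le]; first by rewrite Normc.normc0.
by rewrite (le_trans (le_normcD _ _))// lerD2l.
Qed.

Lemma normc_sub z w : nc (z - w) = nc (w - z).
Proof. by rewrite -normcN opprB. Qed.

Lemma ler_normcD z w (a b : R) : nc z <= a -> nc w <= b -> nc (z + w) <= a + b.
Proof. by move=> za wb; rewrite (le_trans (le_normcD _ _))// lerD. Qed.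

Lemma normcJ z : nc (conjc z) = nc z.
Proof. by case: z => a b /=; rewrite sqrrN. Qed.

(** The left-hand side is the real part of [z * conjc w]. *)
Lemma Re_mul_le z w : Re z * Re w + Im z * Im w <= nc z * nc w.
Proof.
rewrite -(normcJ w) -Normc.normcM.
apply: le_trans (le_trans (ler_norm _) (normc_Re _)).
by rewrite ReM; case: z; case: w => c d a b /=; rewrite mulrN opprK.
Qed.

End complex_basics.

Section complex_integral.
Context d (T : measurableType d) (R : realType) (mu : {measure set T -> \bar R}).
Implicit Types (f g : T -> R[i]) (A : set T).

Definition cintegrable A f : Prop :=
  mu.-integrable A (EFin \o (fun x => Re (f x))) /\
  mu.-integrable A (EFin \o (fun x => Im (f x))).

Definition cint A f : R[i] :=
  (\int[mu]_(x in A) Re (f x)) +i* (\int[mu]_(x in A) Im (f x)).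

Lemma integrableZ_EFin A (a : R) (h : T -> R) : measurable A ->
  mu.-integrable A (EFin \o h) -> mu.-integrable A (EFin \o (fun x => a * h x)).
Proof.
move=> mA ih; rewrite (_ : _ \o _ = (fun x => a%:E * (h x)%:E)%E) //.
exact: integrableZl.
Qed.

Lemma integrableD_EFin A (h k : T -> R) : measurable A ->
  mu.-integrable A (EFin \o h) -> mu.-integrable A (EFin \o k) ->
  mu.-integrable A (EFin \o (fun x => h x + k x)).
Proof.
move=> mA ih ik; rewrite (_ : _ \o _ = (fun x => (h x)%:E + (k x)%:E)%E) //.
exact: integrableD.
Qed.

Lemma cintegrableS A B f : measurable A -> measurable B -> B `<=` A ->
  cintegrable A f -> cintegrable B f.
Proof. by move=> mA mB BA [fr fi]; split; exact: integrableS BA _. Qed.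

Lemma cintegrableD A f g : measurable A -> cintegrable A f -> cintegrable A g ->
  cintegrable A (fun x => f x + g x).
Proof.
move=> mA [fr fi] [gr gi]; split.
- by rewrite (_ : _ \o _ = (fun x => (Re (f x))%:E + (Re (g x))%:E)%E);
    [exact: integrableD|apply/funext => x /=; rewrite ReD].
- by rewrite (_ : _ \o _ = (fun x => (Im (f x))%:E + (Im (g x))%:E)%E);
    [exact: integrableD|apply/funext => x /=; rewrite ImD].
Qed.

Lemma cintegrableZ A (c : R[i]) f : measurable A -> cintegrable A f ->
  cintegrable A (fun x => c * f x).
Proof.
move=> mA [fr fi]; split.
- rewrite (_ : _ \o _ = (fun x => (Re c)%:E * (Re (f x))%:E -
      (Im c)%:E * (Im (f x))%:E)%E).
    by apply: integrableB => //; exact: integrableZl.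
  by apply/funext => x /=; rewrite ReM.
- rewrite (_ : _ \o _ = (fun x => (Re c)%:E * (Im (f x))%:E +
      (Im c)%:E * (Re (f x))%:E)%E).
    by apply: integrableD => //; exact: integrableZl.
  by apply/funext => x /=; rewrite ImM.
Qed.

Lemma cintegrableB A f g : measurable A -> cintegrable A f -> cintegrable A g ->
  cintegrable A (fun x => f x - g x).
Proof.
move=> mA fi gi.
rewrite (_ : (fun x => _) = (fun x => f x + (-1) * g x)).
  by apply: cintegrableD => //; exact: cintegrableZ.
by apply/funext => x; rewrite mulN1r.
Qed.

Lemma cintD A f g : measurable A -> cintegrable A f -> cintegrable A g ->
  cint A (fun x => f x + g x) = cint A f + cint A g.
Proof.
move=> mA [fr fi] [gr gi]; rewrite /cint; apply: complex_ext => /=.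
- by rewrite -RintegralD//; apply: eq_Rintegral => x _; rewrite ReD.
- by rewrite -RintegralD//; apply: eq_Rintegral => x _; rewrite ImD.
Qed.

Lemma cintZ A (c : R[i]) f : measurable A -> cintegrable A f ->
  cint A (fun x => c * f x) = c * cint A f.
Proof.
move=> mA [fr fi]; rewrite /cint; apply: complex_ext => /=.
- rewrite ReM/= -!RintegralZl// -RintegralB//; last 2 first.
  + exact: integrableZ_EFin.
  + exact: integrableZ_EFin.
  by apply: eq_Rintegral => x _; rewrite ReM.
- rewrite ImM/= -!RintegralZl// -RintegralD//; last 2 first.
  + exact: integrableZ_EFin.
  + exact: integrableZ_EFin.
  by apply: eq_Rintegral => x _; rewrite ImM.
Qed.

Lemma cintB A f g : measurable A -> cintegrable A f -> cintegrable A g ->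
  cint A (fun x => f x - g x) = cint A f - cint A g.
Proof.
move=> mA fi gi.
rewrite (_ : (fun x => _) = (fun x => f x + (-1) * g x)); last first.
  by apply/funext => x; rewrite mulN1r.
rewrite cintD//; last exact: cintegrableZ.
by rewrite cintZ// mulN1r.
Qed.

Lemma cintegrable_sum A (I : Type) (s : seq I) (F : I -> T -> R[i]) :
  measurable A -> (forall i, cintegrable A (F i)) ->
  cintegrable A (fun x => \sum_(i <- s) F i x).
Proof.
move=> mA Fi; elim: s => [|i s ih].
  by split; under eq_fun do rewrite big_nil; exact: integrable0.
under eq_fun do rewrite big_cons; exact: cintegrableD.
Qed.

Lemma cint_sum A (I : Type) (s : seq I) (F : I -> T -> R[i]) :
  measurable A -> (forall i, cintegrable A (F i)) ->
  cint A (fun x => \sum_(i <- s) F i x) = \sum_(i <- s) cint A (F i).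
Proof.
move=> mA Fi; elim: s => [|i s ih].
  rewrite big_nil; apply: complex_ext => /=.
  - by under eq_Rintegral do rewrite big_nil /=; rewrite Rintegral_cst// mul0r.
  - by under eq_Rintegral do rewrite big_nil /=; rewrite Rintegral_cst// mul0r.
rewrite big_cons -ih -cintD//; last exact: cintegrable_sum.
by congr cint; apply/funext => x; rewrite big_cons.
Qed.

Lemma measurable_normc A f : measurable_fun A (fun x => Re (f x)) ->
  measurable_fun A (fun x => Im (f x)) -> measurable_fun A (fun x => nc (f x)).
Proof.
move=> mr mi.
rewrite (_ : (fun x => _) =
    Num.sqrt \o (fun x => Re (f x) ^+ 2 + Im (f x) ^+ 2)); last first.
  by apply/funext => x /=; case: (f x).
apply: measurableT_comp.
  by apply: continuous_measurable_fun; exact: sqrt_continuous.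
by apply: measurable_funD; exact: measurable_funX.
Qed.

Lemma integrable_normc A f : measurable A -> cintegrable A f ->
  mu.-integrable A (EFin \o (fun x => nc (f x))).
Proof.
move=> mA [fr fi].
have i2 : mu.-integrable A (fun x => `|(Re (f x))%:E| + `|(Im (f x))%:E|)%E.
  by apply: integrableD => //; exact: integrable_abse.
apply: le_integrable i2 => //.
  apply/measurable_EFinP/measurable_normc; apply/measurable_EFinP.
  - exact: measurable_int fr.
  - exact: measurable_int fi.
move=> x _ /=; rewrite lee_fin.
rewrite ger0_norm ?normc_ge0// ger0_norm ?addr_ge0//.
exact: normc_le_abs.
Qed.

(** With z the integral, [nc z ^+ 2] is the integral of the real part of [conjc z * f x], which is
    at most [nc z * nc (f x)] pointwise; then divide by [nc z]. *)
Lemma normc_cint A f : measurable A -> cintegrable A f ->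
  nc (cint A f) <= \int[mu]_(x in A) nc (f x).
Proof.
move=> mA fi; have [fr fim] := fi.
set z := cint A f.
have [z0|z0] := eqVneq (nc z) 0.
  by rewrite z0; apply: Rintegral_ge0 => x _; exact: normc_ge0.
have zp : 0 < nc z by rewrite lt_def z0 normc_ge0.
have -> : \int[mu]_(x in A) nc (f x) = (nc z)^-1 * \int[mu]_(x in A) (nc z * nc (f x)).
  by rewrite RintegralZl ?mulKf//; exact: integrable_normc.
rewrite -(ler_pM2l zp) mulVKf// -expr2 normc_sqr !expr2.
have hr : Re z * Re z = \int[mu]_(x in A) (Re z * Re (f x)) by rewrite RintegralZl.
have hi : Im z * Im z = \int[mu]_(x in A) (Im z * Im (f x)) by rewrite RintegralZl.
rewrite hr hi -RintegralD//; last 2 first.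
- exact: integrableZ_EFin.
- exact: integrableZ_EFin.
apply: le_Rintegral => //.
- by apply: integrableD_EFin => //; exact: integrableZ_EFin.
- by apply: integrableZ_EFin => //; exact: integrable_normc.
- by move=> x _; exact: Re_mul_le.
Qed.

End complex_integral.

(** * Integration over the circle *)

Section haar_integral.
Context {R : realType}.
Local Notation leb := (@lebesgue_measure R).
Local Notation haar := (@haar R).

Let m01 : measurable (`[0, 1] : set R). Proof. exact: measurable_itv. Qed.

Let mexp : measurable_fun [set: measurableTypeR R]
  (circle_exp : measurableTypeR R -> circle R).
Proof. exact: measurable_circle_exp. Qed.

(** [haar] is the image under [circle_exp] of Lebesgue measure restricted to [0, 1], so this is a
    change of variables; the complement of [0, 1] is null for the restriction and is then
    discarded. *)
Lemma ge0_integral_haar (f : circle R -> \bar R) : measurable_fun setT f ->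
  (forall z, 0 <= f z)%E ->
  (\int[haar]_z f z = \int[leb]_(t in `[0%R, 1%R]) f (circle_exp t))%E.
Proof.
move=> mf f0.
transitivity (\int[mrestr leb m01]_(t in circle_exp @^-1` setT)
    (f \o circle_exp) t)%E.
  apply: etrans; last first.
    apply: (ge0_integral_pushforward mexp (mrestr leb m01) measurableT mf).
    by move=> *; exact: f0.
  exact: eq_measure_integral.
rewrite preimage_setT.
rewrite (@ge0_negligible_integral _ (measurableTypeR R) _ _ setT
  (~` (`[0%R, 1%R] : set R)))//; last 4 first.
- exact: measurableC.
- by apply: measurableT_comp => //; exact: measurable_circle_exp.
- by move=> x _ /=.
- by rewrite /= /mrestr setICl measure0.
rewrite setTD setCK; apply: eq_measure_integral => A mA A01.
by rewrite /= /mrestr setIidl.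
Qed.

Lemma integrable_haar (f : circle R -> \bar R) : measurable_fun setT f ->
  leb.-integrable `[0, 1] (f \o circle_exp) -> haar.-integrable setT f.
Proof.
move=> mf /integrableP[_ foo]; apply/integrableP; split => //.
rewrite ge0_integral_haar//.
by apply: measurableT_comp.
Qed.

Lemma integral_haar (f : circle R -> \bar R) : measurable_fun setT f ->
  (\int[haar]_z f z = \int[leb]_(t in `[0%R, 1%R]) f (circle_exp t))%E.
Proof.
move=> mf; rewrite integralE [RHS]integralE.
rewrite !ge0_integral_haar//; last 2 first.
- exact: measurable_funeneg.
- exact: measurable_funepos.
by rewrite funepos.unlock funeneg.unlock.
Qed.

Lemma integrable_haar_exp (f : circle R -> \bar R) : haar.-integrable setT f ->
  leb.-integrable `[0, 1] (f \o circle_exp).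
Proof.
move=> /integrableP[mf foo]; apply/integrableP; split.
  apply: (@measurable_funS _ _ _ _ setT) => //.
  by apply: measurableT_comp => //; exact: measurable_circle_exp.
by move: foo; rewrite ge0_integral_haar//; exact: measurableT_comp.
Qed.

Lemma measurable_continuous_circle (h : circle R -> R) : continuous h ->
  measurable_fun setT h.
Proof.
move=> ch.
suff : measurable_fun setT (h : circle R -> measurableTypeR R) by [].
apply: (measurability (@RGenOpens.G R)).
  exact: RGenOpens.measurableE.
move=> _ [_ [a [b ->]] <-]; rewrite setTI; apply: sub_sigma_algebra.
by move/continuousP : ch; apply; exact: interval_open.
Qed.

Lemma integrable_continuous_circle (h : circle R -> R) : continuous h ->
  haar.-integrable setT (EFin \o h).
Proof.
move=> ch; apply: integrable_haar.
  by apply/measurable_EFinP; exact: measurable_continuous_circle.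
rewrite (_ : _ \o _ = EFin \o (h \o circle_exp)) //.
apply: continuous_compact_integrable; first exact: segment_compact.
apply: continuous_subspaceT => t.
by apply: continuous_comp; [exact: continuous_circle_exp|exact: ch].
Qed.

End haar_integral.

(** * Continuity of complex functions, part by part *)

Section ccontinuous.
Context {R : realType} {T : topologicalType}.
Implicit Types f g : T -> R[i].

Definition ccontinuous f : Prop :=
  continuous (fun x => Re (f x)) /\ continuous (fun x => Im (f x)).

Lemma ccontinuousP f : ccontinuous f <-> continuous f.
Proof.
split=> [[cr ci]|cf].
  rewrite (_ : f = fun x => Re (f x) +i* Im (f x)); first exact: continuous_Complex.
  by apply/funext => x; case: (f x).
split=> x.
- exact: (continuous_comp (cf x) (@continuous_Re R (f x))).
- exact: (continuous_comp (cf x) (@continuous_Im R (f x))).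
Qed.

Lemma ccontinuous_cst (c : R[i]) : ccontinuous (fun=> c).
Proof. by split=> x; exact: cvg_cst. Qed.

Lemma ccontinuousD f g : ccontinuous f -> ccontinuous g ->
  ccontinuous (fun x => f x + g x).
Proof.
move=> [fr fi] [gr gi]; split=> x.
- under eq_fun do rewrite ReD; exact: cvgD (fr x) (gr x).
- under eq_fun do rewrite ImD; exact: cvgD (fi x) (gi x).
Qed.

Lemma ccontinuousM f g : ccontinuous f -> ccontinuous g ->
  ccontinuous (fun x => f x * g x).
Proof.
move=> [fr fi] [gr gi]; split=> x.
- under eq_fun do rewrite ReM; exact: cvgB (cvgM (fr x) (gr x)) (cvgM (fi x) (gi x)).
- under eq_fun do rewrite ImM; exact: cvgD (cvgM (fr x) (gi x)) (cvgM (fi x) (gr x)).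
Qed.

Lemma ccontinuousB f g : ccontinuous f -> ccontinuous g ->
  ccontinuous (fun x => f x - g x).
Proof.
move=> cf cg; rewrite (_ : (fun x => _) = (fun x => f x + (-1) * g x)).
  by apply: ccontinuousD => //; apply: ccontinuousM => //; exact: ccontinuous_cst.
by apply/funext => x; rewrite mulN1r.
Qed.

Lemma ccontinuous_sum (I : Type) (s : seq I) (F : I -> T -> R[i]) :
  (forall i, ccontinuous (F i)) -> ccontinuous (fun x => \sum_(i <- s) F i x).
Proof.
move=> cF; elim: s => [|i s ih].
  by under eq_fun do rewrite big_nil; exact: ccontinuous_cst.
by under eq_fun do rewrite big_cons; exact: ccontinuousD.
Qed.

Lemma continuous_normc f : ccontinuous f -> continuous (fun x => nc (f x)).
Proof.
move=> [fr fi] x.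
rewrite (_ : (fun x => _) =
    Num.sqrt \o (fun x => Re (f x) * Re (f x) + Im (f x) * Im (f x))); last first.
  by apply/funext => y /=; case: (f y).
apply: continuous_comp; last exact: sqrt_continuous.
exact: cvgD (cvgM (fr x) (fr x)) (cvgM (fi x) (fi x)).
Qed.

End ccontinuous.

(** * Characters of the circle *)

Section characters.
Context {R : realType}.
Implicit Types (z w : circle R) (n m : int).

Definition chr n z : R[i] := set_val z ^ n.
Arguments chr : simpl never.

Lemma normc_val z : nc (set_val z) = 1.
Proof.
have := set_valP z; rewrite /mkset norm_normc => -[]; exact.
Qed.

Lemma val_unit z : set_val z \is a GRing.unit.
Proof.
rewrite unitfE; apply/eqP => z0; have := normc_val z.
by rewrite z0 Normc.normc0 => /esym/eqP; rewrite oner_eq0.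
Qed.

Lemma chr0 z : chr 0 z = 1. Proof. by []. Qed.

Lemma chrD n m z : chr (n + m) z = chr n z * chr m z.
Proof. by rewrite /chr exprzDr// val_unit. Qed.

Lemma chrN n z : chr (- n) z = (chr n z)^-1.
Proof. by rewrite /chr invr_expz. Qed.

Lemma normc_chr n z : nc (chr n z) = 1.
Proof.
suff H (k : nat) : nc (chr k z) = 1.
  by case: n => n //; rewrite NegzE chrN Normc.normcV H invr1.
elim: k => [|k ih]; first by rewrite chr0 Normc.normc1.
by rewrite -add1n PoszD chrD Normc.normcM ih /chr expr1z normc_val mulr1.
Qed.

Lemma mulr_conj (z : R[i]) : z * conjc z = (nc z ^+ 2)%:C.
Proof.
rewrite normc_sqr; case: z => a b /=; rewrite /GRing.mul /=.
by congr (_ +i* _); ring.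
Qed.

Lemma chr_neq0 n z : chr n z != 0.
Proof.
by apply/eqP => e; have := normc_chr n z; rewrite e Normc.normc0 => /esym/eqP;
  rewrite oner_eq0.
Qed.

Lemma chr_exprn (k : nat) z : chr k z = chr 1 z ^+ k.
Proof. by rewrite /chr expr1z. Qed.

Lemma chrNJ n z : chr (- n) z = conjc (chr n z).
Proof.
have u := chr_neq0 n z.
by apply: (mulfI u); rewrite mulr_conj normc_chr expr1n chrN divff.
Qed.

Lemma ccontinuous_val : ccontinuous (fun z : circle R => set_val z).
Proof.
apply/ccontinuousP.
apply/continuousP => B oB; by exists B.
Qed.

Lemma ccontinuous_conj (T : topologicalType) (f : T -> R[i]) : ccontinuous f ->
  ccontinuous (fun x => conjc (f x)).
Proof.
move=> [fr fi]; split=> x.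
- rewrite (_ : (fun x => _) = (fun x => Re (f x))); first exact: fr.
  by apply/funext => y; case: (f y).
- rewrite (_ : (fun x => _) = (fun x => - Im (f x))); first exact: cvgN (fi x).
  by apply/funext => y; case: (f y).
Qed.

Lemma ccontinuous_chr n : ccontinuous (chr n).
Proof.
have H (k : nat) : ccontinuous (chr k).
  elim: k => [|k ih]; first exact: ccontinuous_cst.
  rewrite (_ : chr k.+1 = fun z => set_val z * chr k z).
    exact: ccontinuousM ccontinuous_val ih.
  by apply/funext => z; rewrite -add1n PoszD chrD /chr expr1z.
case: n => [n|n]; first exact: H.
rewrite NegzE (_ : chr _ = fun z => conjc (chr n.+1 z)); first exact: ccontinuous_conj.
by apply/funext => z; rewrite chrNJ.
Qed.

Lemma chr_exp n (t : R) : chr n (circle_exp t) =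
  cos (2 * pi * n%:~R * t) +i* sin (2 * pi * n%:~R * t).
Proof.
have H (k : nat) : chr k (circle_exp t) =
    cos (2 * pi * k%:R * t) +i* sin (2 * pi * k%:R * t).
  elim: k => [|k ih]; first by rewrite chr0 !(mulr0, mul0r) cos0 sin0.
  rewrite -add1n PoszD chrD ih natrD.
  have -> : 2 * pi * (1 + k%:R) * t = 2 * pi * t + 2 * pi * k%:R * t by ring.
  rewrite cosD sinD /chr expr1z /=; apply: complex_ext.
  - by rewrite ReM.
  - by rewrite ImM /= addrC.
case: n => [n|n]; first exact: H.
rewrite NegzE chrNJ H /= mulrNz mulrN !mulNr cosN sinN.
by [].
Qed.

End characters.
Arguments chr : simpl never.

Section cint_haar.
Context {R : realType}.
Local Notation haar := (@haar R).

Lemma ccontinuous_cintegrable (f : circle R -> R[i]) : ccontinuous f ->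
  cintegrable haar setT f.
Proof. by move=> [fr fi]; split; exact: integrable_continuous_circle. Qed.

Lemma integral_cos (a : R) : a != 0 -> sin a = 0 ->
  \int[lebesgue_measure]_(t in `[0, 1]) cos (a * t) = 0.
Proof.
move=> a0 sa; rewrite /Rintegral.
rewrite (@continuous_FTC2 _ _ (fun t => a^-1 * sin (a * t)))//.
- by rewrite mulr1 mulr0 sa sin0 !mulr0 subee.
- apply: continuous_subspaceT => x.
  apply: continuous_comp; first exact: mulrl_continuous.
  exact: continuous_cos.
- split => [x _| |].
  + exact: ex_derive.
  + apply: cvg_at_right_filter; apply: cvgMr.
    apply: continuous_comp; first exact: mulrl_continuous.
    exact: continuous_sin.
  + apply: cvg_at_left_filter; apply: cvgMr.
    apply: continuous_comp; first exact: mulrl_continuous.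
    exact: continuous_sin.
- move=> x _; rewrite derive1E; apply: derive_val.
  apply: is_derive_eq; rewrite /GRing.scale /= !(mulr1, mul1r, mulr0, addr0, add0r).
  by rewrite mulrCA mulVf// mulr1.
Qed.

Lemma integral_sin (a : R) : a != 0 -> cos a = 1 ->
  \int[lebesgue_measure]_(t in `[0, 1]) sin (a * t) = 0.
Proof.
move=> a0 ca; rewrite /Rintegral.
rewrite (@continuous_FTC2 _ _ (fun t => a^-1 * - cos (a * t)))//.
- by rewrite mulr1 mulr0 ca cos0 subee.
- apply: continuous_subspaceT => x.
  apply: continuous_comp; first exact: mulrl_continuous.
  exact: continuous_sin.
- split => [x _| |].
  + exact: ex_derive.
  + apply: cvg_at_right_filter; apply: cvgMr; apply: cvgN.
    apply: continuous_comp; first exact: mulrl_continuous.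
    exact: continuous_cos.
  + apply: cvg_at_left_filter; apply: cvgMr; apply: cvgN.
    apply: continuous_comp; first exact: mulrl_continuous.
    exact: continuous_cos.
- move=> x _; rewrite derive1E; apply: derive_val.
  apply: is_derive_eq; rewrite /GRing.scale /= !(mulr1, mul1r, mulr0, addr0, add0r).
  by rewrite -mulNr opprK mulrCA mulVf// mulr1.
Qed.

Lemma circle_exp1 : set_val (circle_exp (1 : R)) = 1.
Proof.
have -> : set_val (circle_exp (1 : R)) = cos (2 * pi * 1) +i* sin (2 * pi * 1).
  by [].
by rewrite mulr1 mulr_natl cos2pi sin2pi.
Qed.

Lemma integral_haar_continuous (h : circle R -> R) : continuous h ->
  \int[haar]_z h z = \int[lebesgue_measure]_(t in `[0, 1]) h (circle_exp t).
Proof.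
move=> ch; rewrite /Rintegral integral_haar//.
by apply/measurable_EFinP; exact: measurable_continuous_circle.
Qed.

Lemma cint_chr (n : int) : cint haar setT (chr n) = (n == 0)%:R.
Proof.
rewrite /cint; have [cr ci] := @ccontinuous_chr R n.
have [->|n0] := eqVneq n 0.
  apply: complex_ext => /=; rewrite Rintegral_cst//= ?mul0r//.
  by rewrite haar_setT /= mulr1.
rewrite !integral_haar_continuous//.
(* Evaluating [chr n] at [circle_exp 1], which is the point 1, yields the cosine and sine of 2 pi n
   at once. *)
have := chr_exp n (1 : R); rewrite /chr circle_exp1 exp1rz mulr1 => -[c1 s0].
have a0 : 2 * pi * n%:~R != 0 :> R.
  by rewrite mulf_neq0 ?intr_eq0// mulf_neq0 ?pnatr_eq0// gt_eqF// pi_gt0.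
apply: complex_ext => /=.
- under eq_Rintegral do rewrite -/(chr _ _) chr_exp/=.
  exact: integral_cos.
- under eq_Rintegral do rewrite -/(chr _ _) chr_exp/=.
  exact: integral_sin.
Qed.

End cint_haar.

(** * Trigonometric polynomials *)

Section trigonometric_polynomials.
Context {R : realType}.
Local Notation haar := (@haar R).
Implicit Types (s t : seq (int * R[i])) (n m : int).

(* A trigonometric polynomial is given by a list of pairs (frequency,
   coefficient), in which a frequency may occur several times. *)
Definition tp s (z : circle R) : R[i] := \sum_(x <- s) x.2 * chr x.1 z.
Definition tpc s n : R[i] := \sum_(x <- s | x.1 == n) x.2.

Definition tscale (c : R[i]) s := [seq (x.1, c * x.2) | x <- s].
Definition tmul s t := [seq (x.1 + y.1, x.2 * y.2) | x <- s, y <- t].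
Definition tdeg s : nat := \max_(x <- s) `|x.1|%N.

Lemma tp_cat s t z : tp (s ++ t) z = tp s z + tp t z.
Proof. by rewrite /tp big_cat. Qed.

Lemma tpc_cat s t n : tpc (s ++ t) n = tpc s n + tpc t n.
Proof. by rewrite /tpc big_cat. Qed.

Lemma tp_scale c s z : tp (tscale c s) z = c * tp s z.
Proof.
by rewrite /tp big_map mulr_sumr; apply: eq_bigr => x _ /=; rewrite mulrA.
Qed.

Lemma tpc_scale c s n : tpc (tscale c s) n = c * tpc s n.
Proof. by rewrite /tpc big_map mulr_sumr. Qed.

Lemma tp_mul s t z : tp (tmul s t) z = tp s z * tp t z.
Proof.
rewrite /tp big_allpairs_dep mulr_suml; apply: eq_bigr => x _.
rewrite mulr_sumr; apply: eq_bigr => y _ /=.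
by rewrite chrD mulrACA.
Qed.

Lemma tpc_mul s t n : tpc (tmul s t) n = \sum_(x <- s) x.2 * tpc t (n - x.1).
Proof.
rewrite /tpc big_mkcond big_allpairs_dep; apply: eq_bigr => x _.
rewrite mulr_sumr [RHS]big_mkcond; apply: eq_bigr => y _ /=.
by rewrite [in RHS]eq_sym subr_eq [in RHS]eq_sym [in RHS]addrC.
Qed.

Lemma ccontinuous_tp s : ccontinuous (tp s).
Proof.
apply: ccontinuous_sum => x; apply: ccontinuousM; first exact: ccontinuous_cst.
exact: ccontinuous_chr.
Qed.

Lemma fourier_coefE (f : circle R -> R[i]) n :
  fourier_coef f n = cint haar setT (fun z => f z * chr (- n) z).
Proof. by []. Qed.

Lemma fourier_coef_chr m n : fourier_coef (@chr R m) n = (m == n)%:R.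
Proof.
rewrite fourier_coefE (_ : (fun z => _) = chr (m - n)).
  by rewrite cint_chr subr_eq0.
by apply/funext => z; rewrite chrD.
Qed.

Lemma fourier_coefD (f g : circle R -> R[i]) n : ccontinuous f -> ccontinuous g ->
  fourier_coef (fun z => f z + g z) n = fourier_coef f n + fourier_coef g n.
Proof.
move=> cf cg; rewrite !fourier_coefE -cintD//.
- by congr cint; apply/funext => z; rewrite mulrDl.
- apply: ccontinuous_cintegrable; apply: ccontinuousM => //; exact: ccontinuous_chr.
- apply: ccontinuous_cintegrable; apply: ccontinuousM => //; exact: ccontinuous_chr.
Qed.

Lemma fourier_coefZ (c : R[i]) (f : circle R -> R[i]) n : ccontinuous f ->
  fourier_coef (fun z => c * f z) n = c * fourier_coef f n.
Proof.
move=> cf; rewrite !fourier_coefE -cintZ//.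
- by congr cint; apply/funext => z; rewrite mulrA.
- apply: ccontinuous_cintegrable; apply: ccontinuousM => //; exact: ccontinuous_chr.
Qed.

Lemma fourier_coefB (f g : circle R -> R[i]) n : ccontinuous f -> ccontinuous g ->
  fourier_coef (fun z => f z - g z) n = fourier_coef f n - fourier_coef g n.
Proof.
move=> cf cg; rewrite !fourier_coefE -cintB//.
- by congr cint; apply/funext => z; rewrite mulrBl.
- apply: ccontinuous_cintegrable; apply: ccontinuousM => //; exact: ccontinuous_chr.
- apply: ccontinuous_cintegrable; apply: ccontinuousM => //; exact: ccontinuous_chr.
Qed.

Lemma fourier_coef_tp s n : fourier_coef (tp s) n = tpc s n.
Proof.
elim: s => [|x s ih].
  rewrite /tpc big_nil (_ : tp [::] = fun z => 0 * chr 0 z).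
    by rewrite fourier_coefZ ?mul0r//; exact: ccontinuous_chr.
  by apply/funext => z; rewrite /tp big_nil mul0r.
rewrite (_ : tp (x :: s) = fun z => x.2 * chr x.1 z + tp s z); last first.
  by apply/funext => z; rewrite /tp big_cons.
have cx := @ccontinuous_chr R x.1.
rewrite fourier_coefD ?ih; last 2 first.
- by apply: ccontinuousM => //; exact: ccontinuous_cst.
- exact: ccontinuous_tp.
rewrite fourier_coefZ// fourier_coef_chr /tpc big_cons.
by case: eqP => _; rewrite ?mulr1// mulr0 add0r.
Qed.

Lemma fourier_coef_le (f : circle R -> R[i]) n : ccontinuous f ->
  nc (fourier_coef f n) <= \int[haar]_z nc (f z).
Proof.
move=> cf; rewrite fourier_coefE (le_trans (normc_cint _ _))//.
  by apply: ccontinuous_cintegrable; apply: ccontinuousM => //; exact: ccontinuous_chr.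
rewrite le_eqVlt; apply/orP; left; apply/eqP.
by apply: eq_Rintegral => z _; rewrite Normc.normcM normc_chr mulr1.
Qed.

Lemma Rintegral_haar_le (h : circle R -> R) (B : R) : continuous h ->
  (forall z, h z <= B) -> \int[haar]_z h z <= B.
Proof.
move=> ch hB.
have -> : B = \int[haar]_z (fun=> B) z.
  by rewrite Rintegral_cst//= haar_setT mulr1.
apply: le_Rintegral => //; first exact: integrable_continuous_circle.
by apply: integrable_continuous_circle; exact: cst_continuous.
Qed.

Lemma fourier_coef_sup (f : circle R -> R[i]) n (B : R) : ccontinuous f ->
  (forall z, nc (f z) <= B) -> nc (fourier_coef f n) <= B.
Proof.
move=> cf fB; rewrite (le_trans (fourier_coef_le _ cf))//.
by apply: Rintegral_haar_le => //; exact: continuous_normc.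
Qed.

Lemma tdeg_tpc s n : (tdeg s < `|n|)%N -> tpc s n = 0.
Proof.
move=> sn; rewrite /tpc big_seq_cond big_pred0// => x.
apply/negP => /andP[xs /eqP xn]; move: sn; rewrite ltnNge -xn => /negP; apply.
by rewrite /tdeg; exact: leq_bigmax_seq.
Qed.

(** Enumerates the integers from -D to D by a finite type, which later also indexes the coordinates
    of a finite-dimensional space. *)
Definition freq (D : nat) (i : 'I_(D + D).+1) : int := i%:Z - D%:Z.

Lemma freq_le D (i : 'I_(D + D).+1) : (`|freq i| <= D)%N.
Proof. by case: i => i Hi; rewrite /freq /=; lia. Qed.

Lemma freq_inj D : injective (@freq D).
Proof. by move=> i j /addIr [] /val_inj. Qed.

Lemma freq_surj D n : (`|n| <= D)%N -> exists i : 'I_(D + D).+1, freq i = n.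
Proof.
move=> nD; have H : (absz (n + D%:Z)%R < (D + D).+1)%N by lia.
exists (Ordinal H); rewrite /freq /=; lia.
Qed.

Definition tfreq D (c : int -> R[i]) : seq (int * R[i]) :=
  [seq (freq i, c (freq i)) | i <- enum 'I_(D + D).+1].

Lemma tp_freq D c z :
  tp (tfreq D c) z = \sum_(i < (D + D).+1) c (freq i) * chr (freq i) z.
Proof. by rewrite /tp big_map big_enum. Qed.

Lemma tpc_freq D c n : tpc (tfreq D c) n = if (`|n| <= D)%N then c n else 0.
Proof.
rewrite /tpc big_map big_enum_cond/=; case: ifPn => [/freq_surj [i0 <-]|nD].
  rewrite (bigD1 i0)//= big1 ?addr0// => i /andP[/eqP/freq_inj ->].
  by rewrite eqxx.
by rewrite big_pred0// => i; apply: contraNF nD => /eqP <-; exact: freq_le.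
Qed.

End trigonometric_polynomials.

(** * The kernel |z + w|^(2M), and density of trigonometric polynomials *)

Section kernel.
Context {R : realType}.
Local Notation haar := (@haar R).
Implicit Types (z w : circle R) (n : int) (M : nat).

(** The coefficients of |z + w|^(2M), normalised to be 1 at frequency 0. The formula is meaningful
    for |n| <= M, the range to which [tfreq] restricts it. *)
Definition kerc M n : R :=
  'C(M + M, absz (n + M%:Z)%R)%:R / 'C(M + M, M)%:R.

Definition kers M w : seq (int * R[i]) :=
  tfreq M (fun k => (kerc M k)%:C * chr (- k) w).

(** This is |z + w|^(2M) divided by the central binomial coefficient. By the parallelogram law |z +
    w|^2 = 4 - |z - w|^2; this form shows the peak at z = w. *)
Definition ker M z w : R :=
  (4 - nc (chr 1 z - chr 1 w) ^+ 2) ^+ M / 'C(M + M, M)%:R.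

Let binMM M : 'C(M + M, M)%:R != 0 :> R.
Proof. by rewrite pnatr_eq0 -lt0n bin_gt0 leq_addr. Qed.

Lemma conjc_chr1 z : conjc (chr 1 z) = (chr 1 z)^-1.
Proof. by rewrite -chrNJ chrN. Qed.

Lemma realcM (a b : R) : (a * b)%:C = a%:C * b%:C.
Proof. exact: rmorphM. Qed.

Lemma conjcD (a b : R[i]) : conjc (a + b) = conjc a + conjc b.
Proof. exact: rmorphD. Qed.

Lemma conjcB (a b : R[i]) : conjc (a - b) = conjc a - conjc b.
Proof. exact: rmorphB. Qed.

Lemma normc_addB (a b : R[i]) : nc a = 1 -> nc b = 1 ->
  nc (a + b) ^+ 2 = 4 - nc (a - b) ^+ 2.
Proof.
move=> a1 b1; have := normc_sqr a; have := normc_sqr b.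
rewrite a1 b1 !normc_sqr !expr1n.
by case: a {a1} => a a'; case: b {b1} => b b' /= h1 h2; nra.
Qed.

(** On the circle |z + w|^2 = (z + w)(1/z + 1/w) = (w + z)^2 / (z w). The binomial theorem with
    exponent 2M, divided by (z w)^M, gives the coefficients. *)
Lemma ker_sum M z w : tp (kers M w) z = (ker M z w)%:C.
Proof.
have z0 : chr 1 z != 0 by exact: chr_neq0.
have w0 : chr 1 w != 0 by exact: chr_neq0.
have kz : ker M z w = (nc (chr 1 z + chr 1 w) ^+ 2) ^+ M / 'C(M + M, M)%:R.
  by rewrite /ker (@normc_addB (chr 1 z) (chr 1 w)) ?normc_chr.
rewrite kz rmorphM/= rmorphXn/= -mulr_conj conjcD !conjc_chr1.
have -> : (chr 1 z + chr 1 w) * ((chr 1 z)^-1 + (chr 1 w)^-1) =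
    (chr 1 w + chr 1 z) ^+ 2 * (chr 1 z)^-1 * (chr 1 w)^-1 :> R[i].
  by move: z0 w0; move: (chr 1 z) (chr 1 w) => a b a0 b0; field; rewrite a0 b0.
rewrite exprMn exprMn -exprM mul2n -addnn exprDn tp_freq.
rewrite !mulr_suml; apply: eq_bigr => i _.
rewrite /kerc /freq subrK absz_nat.
rewrite rmorphM/= rmorph_nat fmorphV/= rmorph_nat.
have iM : (i <= M + M)%N by rewrite -ltnS.
have -> : - (i%:Z - M%:Z) = (M + M - i)%N%:Z - M%:Z by lia.
rewrite !chrD !chrN (chr_exprn i) !(chr_exprn M) (chr_exprn (M + M - i)).
rewrite !exprVn.
move: ((_ ^+ M)^-1) ((_ ^+ M)^-1) (_ ^+ i) (_ ^+ (M + M - i)) => p q u v.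
rewrite -[v * u *+ _]mulr_natl.
by move: (_%:R) (_%:R^-1) => a b; ring.
Qed.

Lemma ker_ge0 M z w : 0 <= ker M z w.
Proof.
rewrite /ker -(@normc_addB (chr 1 z) (chr 1 w)) ?normc_chr//.
by rewrite divr_ge0// exprn_ge0// sqr_ge0.
Qed.

Lemma kerC M z w : ker M z w = ker M w z.
Proof. by rewrite /ker normc_sub. Qed.

Lemma tpc_kers M w n : tpc (kers M w) n =
  if (`|n| <= M)%N then (kerc M n)%:C * chr (- n) w else 0.
Proof. exact: tpc_freq. Qed.

Lemma kerc0 M : kerc M 0 = 1.
Proof. by rewrite /kerc add0r absz_nat divff. Qed.

Lemma kercN M n : (`|n| <= M)%N -> kerc M (- n) = kerc M n.
Proof.
move=> nM; rewrite /kerc.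
have -> : absz (- n + M%:Z)%R = (M + M - absz (n + M%:Z)%R)%N by lia.
by rewrite bin_sub//; lia.
Qed.

(** Consecutive coefficients have ratio (M - n) / (M + n + 1), so the drop from n to n + 1 is at
    most (2n + 1) / M, and the first n odd numbers add up to n^2. *)
Lemma kerc_nat M (n : nat) : (0 < M)%N -> (n <= M)%N ->
  1 - (n * n)%:R / M%:R <= kerc M n <= 1.
Proof.
move=> M0; elim: n => [_|n ih nM]; first by rewrite kerc0 mul0r subr0 lexx.
have /andP[lo hi] := ih (ltnW nM).
have Mp : 0 < M%:R :> R by rewrite ltr0n.
have k0 : 0 <= kerc M n by rewrite divr_ge0.
have E : (M + n + 1)%:R * kerc M n.+1 = (M%:R - n%:R) * kerc M n.
  rewrite /kerc mulrA mulrA; congr (_ / _).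
  rewrite -natrB ?(ltnW nM)// -!natrM; congr (_%:R).
  have -> : absz (n.+1%:Z + M%:Z)%R = (M + n).+1 by lia.
  have -> : absz (n%:Z + M%:Z)%R = (M + n)%N by lia.
  by rewrite addn1 mul_bin_left; congr (_ * _)%N; lia.
have Mn0 : 0 < (M + n + 1)%:R :> R by rewrite ltr0n addn1.
have E' : kerc M n.+1 = (M%:R - n%:R) * kerc M n / (M + n + 1)%:R.
  by rewrite -E mulrC mulKf// gt_eqF.
have nMr : n%:R <= M%:R :> R by rewrite ler_nat ltnW.
have n0 : 0 <= n%:R :> R by [].
have D : kerc M n - kerc M n.+1 <= (n + n + 1)%:R / M%:R.
  rewrite E' ler_pdivlMr// !natrD in Mn0 *.
  rewrite -subr_ge0.
  have -> : n%:R + n%:R + 1 - (kerc M n - (M%:R - n%:R) * kerc M n / (M%:R + n%:R + 1)) * M%:R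
   = (n%:R + n%:R + 1) * (M%:R + n%:R + 1 - kerc M n * M%:R) / (M%:R + n%:R + 1).
    by field; rewrite gt_eqF.
  apply: divr_ge0; last exact: ltW.
  apply: mulr_ge0; first by rewrite !addr_ge0.
  by rewrite subr_ge0 (@le_trans _ _ M%:R)// ?ler_piMl ?(ltW Mp)//; lra.
apply/andP; split.
  have -> : (n.+1 * n.+1)%:R = (n * n)%:R + (n + n + 1)%:R :> R.
    by rewrite -natrD; congr (_%:R); lia.
  by rewrite mulrDl; lra.
rewrite E' ler_pdivrMr// mul1r !natrD.
by rewrite (le_trans (ler_piMr _ hi))// ?subr_ge0//; lra.
Qed.

Lemma kerc_bounds M n : (0 < M)%N -> (`|n| <= M)%N ->
  1 - (`|n| * `|n|)%N%:R / M%:R <= kerc M n <= 1.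
Proof.
move=> M0; have [k [->|->]] : exists k : nat, n = k \/ n = - k%:Z.
    by exists (absz n); lia.
  by rewrite absz_nat; exact: kerc_nat.
rewrite abszN absz_nat => nM; rewrite kercN ?absz_nat//.
exact: kerc_nat.
Qed.

Lemma continuous_kerl M w : continuous (ker M ^~ w).
Proof.
have [cr _] := ccontinuous_tp (kers M w).
by rewrite (_ : ker M ^~ w = fun z => Re (tp (kers M w) z)) //;
  apply/funext => z; rewrite ker_sum.
Qed.

Lemma cint_real d (T : measurableType d) (mu : {measure set T -> \bar R})
    (A : set T) (h : T -> R) : measurable A ->
  cint mu A (fun x => (h x)%:C) = (\int[mu]_(x in A) h x)%:C.
Proof. by move=> mA; apply: complex_ext => //=; rewrite Rintegral_cst// mul0r. Qed.

Lemma integral_ker M w : \int[haar]_z ker M z w = 1.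
Proof.
apply: (@complexI R); rewrite -cint_real//.
have -> : (fun z => (ker M z w)%:C) = fun z => tp (kers M w) z * chr (- 0) z.
  by apply/funext => z; rewrite ker_sum oppr0 chr0 mulr1.
rewrite -fourier_coefE fourier_coef_tp tpc_kers /= kerc0 oppr0 chr0 mulr1.
by [].
Qed.

(** Since |z - w|^2 = 2 - z/w - w/z, the integral sees only the coefficients at 0, 1 and -1 and
    equals 2 - 2 [kerc M 1]. *)
Lemma integral_ker_dist M w : (0 < M)%N ->
  \int[haar]_z (ker M z w * nc (chr 1 z - chr 1 w) ^+ 2) <= 2 / M%:R.
Proof.
move=> M0.
pose dd : seq (int * R[i]) := [:: (0, 2%:R); (1, - chr (- 1) w); (- 1, - chr 1 w)].
have ddE z : tp dd z = (nc (chr 1 z - chr 1 w) ^+ 2)%:C.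
  rewrite /tp !big_cons big_nil /= addr0 -mulr_conj conjcB !conjc_chr1.
  rewrite !chrN chr0.
  have z0 : chr 1 z != 0 by exact: chr_neq0.
  have w0 : chr 1 w != 0 by exact: chr_neq0.
  by move: z0 w0; move: (chr 1 z) (chr 1 w) => a b a0 b0; field; rewrite a0 b0.
have E : (\int[haar]_z (ker M z w * nc (chr 1 z - chr 1 w) ^+ 2))%:C =
    (2 - 2 * kerc M 1)%:C.
  rewrite -cint_real//.
  have -> : (fun z => (ker M z w * nc (chr 1 z - chr 1 w) ^+ 2)%:C) =
      fun z => tp (tmul dd (kers M w)) z * chr (- 0) z.
    by apply/funext => z; rewrite tp_mul ker_sum ddE oppr0 chr0 mulr1 -rmorphM mulrC.
  rewrite -fourier_coefE fourier_coef_tp tpc_mul !big_cons big_nil /= addr0.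
  rewrite !tpc_kers !sub0r oppr0 !opprK /= M0 kerc0 chr0.
  rewrite (kercN (n := 1))// chrN.
  have c0 : chr 1 w != 0 by exact: chr_neq0.
  rewrite mulr1 !mulNr mulrCA mulVf// [chr 1 w * _]mulrCA mulfV// !mulr1.
  by move: (kerc M 1) => b; apply: complex_ext => /=; ring.
have {E} [->] := E.
have /andP[+ _] := kerc_nat M0 M0.
by rewrite muln1 => h; lra.
Qed.

End kernel.

(** * Convolution with the kernel *)

Section density.
Context {R : realType}.
Local Notation haar := (@haar R).
Local Notation leb := (@lebesgue_measure R).

Let m01 : measurable (`[0, 1] : set R). Proof. exact: measurable_itv. Qed.

Lemma integrable_continuous_01 (h : R -> R) : continuous h ->
  leb.-integrable `[0, 1] (EFin \o h).
Proof.
move=> ch; apply: continuous_compact_integrable; first exact: segment_compact.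
exact: continuous_subspaceT.
Qed.

Lemma cintegrable_continuous_01 (h : R -> R[i]) : ccontinuous h ->
  cintegrable leb `[0, 1] h.
Proof. by move=> [hr hi]; split; exact: integrable_continuous_01. Qed.

Lemma ccontinuous_comp_exp (f : circle R -> R[i]) : ccontinuous f ->
  ccontinuous (fun t => f (circle_exp t)).
Proof.
move=> [fr fi]; split=> t.
- exact: (continuous_comp (@continuous_circle_exp R t) (fr _)).
- exact: (continuous_comp (@continuous_circle_exp R t) (fi _)).
Qed.

Lemma ccontinuous_real (T : topologicalType) (h : T -> R) : continuous h ->
  ccontinuous (fun x => (h x)%:C).
Proof. by move=> ch; split => //= x; exact: cvg_cst. Qed.

Lemma chr_dist_sqr (s t : R) :
  nc (chr 1 (circle_exp s) - chr 1 (circle_exp t)) ^+ 2 =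
  2 - 2 * cos (2 * pi * (s - t)).
Proof.
rewrite !chr_exp normc_sqr ReB ImB /= !mulr1.
rewrite mulrBr cosB.
have := cos2Dsin2 (2 * pi * s); have := cos2Dsin2 (2 * pi * t).
by move=> h1 h2; nra.
Qed.

(** The bound 1 - x accounts for the identification of the parameters 0 and 1: when u exceeds 1/2
    the arc has length 1 - u, and the cosine is decreasing on the half turn. *)
Lemma chr_dist_far (x s t : R) : 0 < x -> x <= `|s - t| -> `|s - t| <= 1 - x ->
  2 - 2 * cos (2 * pi * x) <=
  nc (chr 1 (circle_exp s) - chr 1 (circle_exp t)) ^+ 2.
Proof.
move=> x0; rewrite chr_dist_sqr; set u := `|s - t| => xu ux.
have -> : cos (2 * pi * (s - t)) = cos (2 * pi * u).
  rewrite /u; have [h|h] := leP 0 (s - t); first by rewrite ger0_norm.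
  by rewrite ltr0_norm// mulrN cosN.
have pi0 := pi_gt0 R.
have H v : x <= v -> v <= 2^-1 -> cos (2 * pi * v) <= cos (2 * pi * x).
  move=> xv v2; rewrite leNgt ltr_cos ?in_itv/= -?leNgt.
  - by rewrite ler_pM2l// mulr_gt0.
  - by apply/andP; split; nra.
  - by apply/andP; split; nra.
rewrite lerD2l lerN2 ler_pM2l//.
have [u2|u2] := leP u 2^-1; first exact: H.
have -> : cos (2 * pi * u) = cos (2 * pi * (1 - u)).
  have -> : 2 * pi * u = - (2 * pi * (1 - u)) + pi *+ 2 by rewrite mulr2n; ring.
  by rewrite cosD2pi cosN.
by apply: H; lra.
Qed.

Lemma cos_lt1 (x : R) : 0 < x -> x <= 2^-1 -> cos (2 * pi * x) < 1.
Proof.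
move=> x0 x2; have pi0 := pi_gt0 R.
rewrite -[ltRHS]cos0 ltr_cos ?in_itv/= ?lexx ?pi_ge0//; first by nra.
by apply/andP; split; nra.
Qed.

Section approximate.
Variable g : R -> R.
Hypothesis cg : continuous g.

Definition conv_ker M (z : circle R) : R :=
  \int[leb]_(t in `[0, 1]) (g t * ker M z (circle_exp t)).

Lemma continuous_kerr M (z : circle R) :
  continuous (fun t => ker M z (circle_exp t)).
Proof.
move=> t; under eq_fun do rewrite kerC.
exact: (continuous_comp (@continuous_circle_exp R t) (@continuous_kerl R M z _)).
Qed.

Lemma integral_ker_01 M z : \int[leb]_(t in `[0, 1]) ker M z (circle_exp t) = 1.
Proof.
rewrite -[RHS](integral_ker M z) integral_haar_continuous.
  by apply: eq_Rintegral => t _; rewrite kerC.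
exact: continuous_kerl.
Qed.

Lemma integral_cst_ker (c : R) M z :
  c = \int[leb]_(t in `[0, 1]) (c * ker M z (circle_exp t)).
Proof.
rewrite RintegralZl ?integral_ker_01 ?mulr1//.
by apply: integrable_continuous_01; exact: continuous_kerr.
Qed.

Lemma conv_ker_tp M : exists s, forall z, tp s z = (conv_ker M z)%:C.
Proof.
pose c k := cint leb `[0, 1] (fun t => (g t)%:C * chr (- k) (circle_exp t)).
have ic (a : R[i]) k : cintegrable leb `[0, 1]
    (fun t => a * ((g t)%:C * chr (- k) (circle_exp t))).
  apply: cintegrable_continuous_01; apply: ccontinuousM.
    exact: ccontinuous_cst.
  apply: ccontinuousM; first exact: ccontinuous_real.
  exact: ccontinuous_comp_exp (ccontinuous_chr _).
exists (tfreq M (fun k => (kerc M k)%:C * c k)) => z; rewrite tp_freq.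
rewrite /conv_ker -cint_real//.
have -> : (fun t => (g t * ker M z (circle_exp t))%:C) =
    fun t => \sum_(i < (M + M).+1) ((kerc M (freq i))%:C * chr (freq i) z) *
      ((g t)%:C * chr (- freq i) (circle_exp t)).
  apply/funext => t; rewrite realcM -ker_sum tp_freq mulr_sumr.
  by apply: eq_bigr => i _; ring.
rewrite (@cint_sum _ _ _ leb _ _ _ (fun i t => ((kerc M (freq i))%:C * chr (freq i) z) *
      ((g t)%:C * chr (- freq i) (circle_exp t))))//.
apply: eq_bigr => i _; rewrite cintZ//; first by rewrite -/(c _); ring.
apply: cintegrable_continuous_01.
apply: ccontinuousM; first exact: ccontinuous_real.
exact: ccontinuous_comp_exp (ccontinuous_chr _).
Qed.

Lemma bounded_01 : exists B : R, 0 < B /\ forall t : R, t \in `[0, 1] -> `|g t| <= B.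
Proof.
have [c _ cmax] : exists2 c : R, c \in `[0, 1] &
    forall t : R, t \in `[0, 1] -> `|g t| <= `|g c|.
  apply: (@EVT_max R (fun t => `|g t|)) => //.
  apply: continuous_subspaceT => x.
  by apply: continuous_comp; [exact: cg|exact: norm_continuous].
exists (`|g c| + 1); split; first by rewrite ltr_wpDl.
by move=> t /cmax h; rewrite (le_trans h)// lerDl.
Qed.

Let kint M (s : R) (h : R -> R) : continuous h -> leb.-integrable `[0, 1]
  (EFin \o (fun t => h t * ker M (circle_exp s) (circle_exp t))).
Proof.
move=> ch; apply: integrable_continuous_01 => t.
exact: cvgM (ch t) (@continuous_kerr M (circle_exp s) t).
Qed.

Let ker_le M (s a : R) (h : R -> R) : continuous h ->
  (forall t : R, t \in `[0, 1] -> `|g s - g t| <= h t) ->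
  \int[leb]_(t in `[0, 1]) (h t * ker M (circle_exp s) (circle_exp t)) <= a ->
  `|g s - conv_ker M (circle_exp s)| <= a.
Proof.
move=> ch gh; apply: le_trans.
have cd : continuous (fun t => g s - g t).
  by move=> t; apply: cvgB; [exact: cvg_cst|exact: cg].
have -> : g s - conv_ker M (circle_exp s) =
    \int[leb]_(t in `[0, 1]) ((g s - g t) * ker M (circle_exp s) (circle_exp t)).
  rewrite {1}(integral_cst_ker (g s) M (circle_exp s)) /conv_ker -RintegralB//.
  - by apply: eq_Rintegral => t _; rewrite mulrBl.
  - by apply: (kint M s (h := fun=> g s)); exact: cst_continuous.
  - exact: kint.
rewrite (le_trans (le_normr_Rintegral _ _))//; first exact: kint.
apply: le_Rintegral => //.
- rewrite (_ : _ \o _ = EFin \o (fun t => `|g s - g t| * ker M (circle_exp s) (circle_exp t))).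
    apply: (kint M s (h := fun t => `|g s - g t|)) => t.
    exact: (continuous_comp (cd t) (@norm_continuous _ _ _)).
  by apply/funext => t /=; rewrite normrM [`|ker _ _ _|]ger0_norm// ker_ge0.
- exact: kint.
- move=> t t01; rewrite normrM [`|ker _ _ _|]ger0_norm ?ker_ge0//.
  by rewrite ler_wpM2r ?ker_ge0// gh.
Qed.

Lemma conv_ker_bound M (B s : R) : s \in `[0, 1] ->
  (forall t : R, t \in `[0, 1] -> `|g t| <= B) ->
  `|g s - conv_ker M (circle_exp s)| <= 2 * B.
Proof.
move=> s01 gB; apply: (@ker_le _ _ _ (fun=> 2 * B)).
- by move=> t; exact: cvg_cst.
- move=> t t01; rewrite (le_trans (ler_normB _ _))//.
  by rewrite mulr_natl mulr2n lerD// gB.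
- rewrite RintegralZl// ?integral_ker_01 ?mulr1//.
  by apply: integrable_continuous_01; exact: continuous_kerr.
Qed.

(** The endpoints are excluded because [circle_exp] identifies 0 and 1, where [g] may take different
    values. Inside, a Chebyshev argument applies: the second moment of the kernel is O(1 / M). *)
Lemma conv_ker_cvg (s : R) : s \in `]0, 1[ ->
  `|g s - conv_ker M.+1 (circle_exp s)| @[M --> \oo] --> 0.
Proof.
rewrite in_itv/= => /andP[s0 s1].
have [B [B0 gB]] := bounded_01.
apply/cvgr0Pnorm_le => e e0.
have /cvgrPdist_lt /(_ (e / 2)) := (@cg s : g t @[t --> s] --> g s).
rewrite divr_gt0// => /(_ isT) [d /= d0 gd].
(* Below d / 2 the continuity of [g] at s applies; the other two bounds ensure |s - t| <= 1 - x for
   every t in [0, 1], as [chr_dist_far] requires. *)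
pose x : R := Num.min (d / 2) (Num.min (s / 2) ((1 - s) / 2)).
have x0 : 0 < x by rewrite !lt_min !divr_gt0//= subr_gt0.
have xd : x < d by rewrite (@le_lt_trans _ _ (d / 2)) ?ge_min ?lexx//; lra.
have xs : x <= s / 2 by rewrite !ge_min lexx orbT.
have xs' : x <= (1 - s) / 2 by rewrite !ge_min lexx !orbT.
pose k := 2 - 2 * cos (2 * pi * x).
have k0 : 0 < k by rewrite /k subr_gt0 gtr_pMr// cos_lt1//; lra.
(* This majorises |g s - g t|: the first term does so near s, and elsewhere the squared chord is at
   least k, so the second is at least 2 B. Against the kernel the second term has integral O(1 /
   M). *)
pose h (t : R) := e / 2 + (2 * B / k) * nc (chr 1 (circle_exp s) - chr 1 (circle_exp t)) ^+ 2.
near=> M; rewrite normr_id; apply: (@ker_le _ _ _ h).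
- move=> t; apply: cvgD; first exact: cvg_cst.
  apply: cvgM; first exact: cvg_cst.
  have cc : continuous (fun t => nc (chr 1 (circle_exp s) - chr 1 (circle_exp t))).
    apply: continuous_normc; apply: ccontinuousB; first exact: ccontinuous_cst.
    exact: ccontinuous_comp_exp (ccontinuous_chr _).
  exact: cvgM (cc t) (cc t).
- move=> t t01; rewrite /h; set n2 := _ ^+ 2.
  have n20 : 0 <= n2 by rewrite sqr_ge0.
  have Bk : 0 <= 2 * B / k by rewrite divr_ge0 ?mulr_ge0// ltW.
  have [st|st] := ltP `|s - t| x.
    rewrite (@le_trans _ _ (e / 2))//; last by rewrite lerDl mulr_ge0.
    by apply/ltW/gd; rewrite /ball_ /= (lt_trans st).
  rewrite (@le_trans _ _ (2 * B))//.
    rewrite (le_trans (ler_normB _ _))// mulr_natl mulr2n lerD// gB//.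
    by rewrite in_itv/= !ltW.
  have kn : k <= n2.
    apply: chr_dist_far => //; move: t01; rewrite in_itv/= => /andP[t0 t1].
    by rewrite ler_norml; apply/andP; split; lra.
  rewrite (@le_trans _ _ (2 * B / k * n2))//; last by rewrite lerDr ltW// divr_gt0.
  by rewrite mulrAC ler_pdivlMr// ler_wpM2l// mulr_ge0// ltW.
- have M1 : 2 * B / k * (2 / M.+1%:R) <= e / 2.
    near: M; apply: filterS (nbhs_infty_ger (2 * B / k * 2 / (e / 2))) => M /=.
    rewrite ler_pdivrMr ?divr_gt0// => hM.
    rewrite mulrA ler_pdivrMr// (le_trans hM)// mulrC ler_pM2l ?divr_gt0//.
    by rewrite ler_nat.
  have i1 : leb.-integrable `[0, 1] (EFin \o (fun t =>
      ker M.+1 (circle_exp s) (circle_exp t))).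
    by apply: integrable_continuous_01; exact: continuous_kerr.
  have cD : continuous (fun z => ker M.+1 z (circle_exp s) *
      nc (chr 1 z - chr 1 (circle_exp s)) ^+ 2).
    have cc : continuous (fun z : circle R => nc (chr 1 z - chr 1 (circle_exp s))).
      apply: continuous_normc; apply: ccontinuousB; last exact: ccontinuous_cst.
      exact: ccontinuous_chr.
    move=> z; exact: cvgM (@continuous_kerl R M.+1 _ z) (cvgM (cc z) (cc z)).
  have i2 : leb.-integrable `[0, 1] (EFin \o (fun t =>
      ker M.+1 (circle_exp t) (circle_exp s) *
      nc (chr 1 (circle_exp t) - chr 1 (circle_exp s)) ^+ 2)).
    apply: integrable_continuous_01 => t.
    exact: (continuous_comp (@continuous_circle_exp R t) (cD _)).
  have -> : \int[leb]_(t in `[0, 1]) (h t * ker M.+1 (circle_exp s) (circle_exp t)) =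
      e / 2 + 2 * B / k * \int[haar]_z (ker M.+1 z (circle_exp s) *
        nc (chr 1 z - chr 1 (circle_exp s)) ^+ 2).
    rewrite integral_haar_continuous//.
    rewrite {1}(integral_cst_ker (e / 2) M.+1 (circle_exp s)).
    rewrite -RintegralZl// -RintegralD//.
    - apply: eq_Rintegral => t _; rewrite /h mulrDl; congr (_ + _).
      rewrite (normc_sub (chr 1 (circle_exp s))) (kerC M.+1 (circle_exp s)).
      by move: (nc _) (ker _ _ _) => a b; ring.
    - exact: integrableZ_EFin.
    - exact: integrableZ_EFin.
  rewrite [leRHS]splitr lerD2l (le_trans _ M1)// ler_wpM2l//.
    by rewrite divr_ge0 ?mulr_ge0// ltW.
  exact: integral_ker_dist.
Unshelve. all: by end_near. Qed.

End approximate.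
End density.

(** * Density in L^1 and the Riemann-Lebesgue lemma *)

Section density_theorem.
Context {R : realType}.
Local Notation haar := (@haar R).
Local Notation leb := (@lebesgue_measure R).

Lemma trig_density_continuous (g : R -> R) (e : R) : continuous g -> 0 < e ->
  exists s, \int[leb]_(t in `[0, 1]) nc ((g t)%:C - tp s (circle_exp t)) <= e.
Proof.
move=> cg e0; have [B [B0 gB]] := bounded_01 cg.
pose f (M : nat) (t : R) := `|g t - conv_ker g M.+1 (circle_exp t)|.
have fE M : exists s, forall t, nc ((g t)%:C - tp s (circle_exp t)) = f M t.
  have [s hs] := conv_ker_tp cg M.+1; exists s => t.
  by rewrite hs /f -normc_real rmorphB.
have cf M : continuous (f M).
  have [s hs] := fE M.
  rewrite (_ : f M = fun t => nc ((g t)%:C - tp s (circle_exp t))); last exact/funext.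
  apply: continuous_normc; apply: ccontinuousB; first exact: ccontinuous_real.
  exact: ccontinuous_comp_exp (ccontinuous_tp _).
have mo : measurable (`]0, 1[ : set R) by exact: measurable_itv.
have sub01 (t : R) : t \in `]0, 1[ -> t \in `[0, 1].
  by apply: subset_itv_oo_cc.
(* Dominated convergence is applied on the open interval, where pointwise convergence holds; the
   endpoints are put back at the end. *)
have : (\int[leb]_(t in `]0%R, 1%R[) (f M t)%:E)%E @[M --> \oo] -->
    (\int[leb]_(t in `]0%R, 1%R[) 0)%E.
  apply: (@dominated_cvg _ _ _ leb _ mo _ _ (fun=> (2 * B)%:E)) => //.
  - move=> M; apply/measurable_EFinP; apply: measurable_funTS.
    exact: continuous_measurable_fun.
  - by move=> t t01; apply: cvg_EFin; [near=> M|exact: conv_ker_cvg].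
  - have iB : leb.-integrable `[0, 1] (EFin \o (fun=> 2 * B)).
      by apply: integrable_continuous_01; exact: cst_continuous.
    by apply: integrableS iB => //; exact: subset_itv_oo_cc.
  - move=> M t t01 /=; rewrite lee_fin /f normr_id.
    apply: conv_ker_bound => //; exact: sub01.
rewrite integral0 => /fine_cvgP[_ /cvgr0Pnorm_le /(_ e e0)] [M _ /(_ M (leqnn M))] /=.
rewrite ger0_norm => [fM|]; last first.
  by apply: fine_ge0; apply: integral_ge0 => t _; rewrite lee_fin; exact: normr_ge0.
have [s hs] := fE M; exists s; rewrite (le_trans _ fM)//.
rewrite le_eqVlt; apply/orP; left; apply/eqP.
have iM := integrable_continuous_01 (cf M).
transitivity (\int[leb]_(t in `[0, 1]) f M t).
  by apply: eq_Rintegral => t _; exact: hs.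
rewrite -Rintegral_itv_bndo_bndc; last first.
  by apply: integrableS iM => //; exact: subset_itv_co_cc.
rewrite -Rintegral_itv_obnd_cbnd//.
by apply: integrableS iM => //; exact: subset_itv_oo_cc.
Unshelve. all: by end_near. Qed.

Lemma trig_density_real (f : circle R -> R) (e : R) :
  haar.-integrable setT (EFin \o f) -> 0 < e ->
  exists s, \int[haar]_z nc ((f z)%:C - tp s z) <= e.
Proof.
move=> fi e0.
have fi' := integrable_haar_exp fi.
have m01 : measurable (`[0, 1] : set R) by exact: measurable_itv.
have [||g [cg ig]] := approximation_continuous_integrable _ _ fi'; first exact: m01.
  by rewrite /= lebesgue_measure_itv /= lte_fin ltr01 -EFinD ltry.
move=> /fine_cvgP[_ /cvgr0Pnorm_le /(_ (e / 2))].
rewrite divr_gt0// => /(_ isT)[n _ /(_ n (leqnn n))] /=.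
rewrite ger0_norm => [gn|]; last first.
  by apply: fine_ge0; apply: integral_ge0 => t _; rewrite lee_fin.
have [|s hs] := @trig_density_continuous (g n) (e / 2) (cg n).
  by rewrite divr_gt0.
exists s.
have mnc : measurable_fun setT (fun z : circle R => nc ((f z)%:C - tp s z)).
  have [cr ci] := @ccontinuous_tp R s.
  apply: measurable_normc.
  - rewrite (_ : (fun z => _) = fun z => f z - Re (tp s z)); last first.
      by apply/funext => z; rewrite ReB.
    apply: measurable_funB; last exact: measurable_continuous_circle.
    by case/integrableP : fi => /measurable_EFinP.
  - rewrite (_ : (fun z => _) = fun z => 0 - Im (tp s z)); last first.
      by apply/funext => z; rewrite ImB.
    by apply: measurable_funB => //; exact: measurable_continuous_circle.
rewrite /Rintegral integral_haar; last exact/measurable_EFinP.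
rewrite [leRHS]splitr (le_trans _ (lerD gn hs))//.
have i1 : leb.-integrable `[0, 1] (EFin \o (fun t => `|f (circle_exp t) - g n t|)).
  rewrite (_ : _ \o _ = fun t => `|(EFin \o (f \o circle_exp)) t - (EFin \o g n) t|)%E//.
  by apply: integrable_abse; apply: integrableB.
have cD : ccontinuous (fun t => (g n t)%:C - tp s (circle_exp t)).
  apply: ccontinuousB; first exact: ccontinuous_real.
  exact: ccontinuous_comp_exp (ccontinuous_tp _).
have i2 := integrable_continuous_01 (continuous_normc cD).
rewrite -/(Rintegral leb `[0, 1] (fun t => `|f (circle_exp t) - g n t|)).
rewrite -RintegralD//; apply: le_Rintegral => //.
- apply: integrable_normc => //; split.
  + rewrite (_ : (fun t => _) = fun t => f (circle_exp t) - Re (tp s (circle_exp t))); last first.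
      by apply/funext => z; rewrite ReB.
    apply: (@integrableB _ _ _ leb `[0, 1]%classic _ (EFin \o (f \o circle_exp))
      (EFin \o (fun t => Re (tp s (circle_exp t))))) => //.
    apply: integrable_continuous_01.
    by have [] := ccontinuous_comp_exp (ccontinuous_tp s).
  + rewrite (_ : (fun t => _) = fun t => - Im (tp s (circle_exp t))); last first.
      by apply/funext => z; rewrite ImB sub0r.
    apply: integrable_continuous_01 => t.
    by have [_ ci] := ccontinuous_comp_exp (ccontinuous_tp s); exact: cvgN (ci t).
- exact: integrableD_EFin.
- move=> t _.
  rewrite -[`|_|]normc_real; apply: le_trans (le_normcD _ _).
  by rewrite rmorphB/= addrA subrK.
Qed.

Lemma trig_density (f : circle R -> R[i]) (e : R) :
  cintegrable haar setT f -> 0 < e ->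
  exists s, \int[haar]_z nc (f z - tp s z) <= e.
Proof.
move=> [fr fi] e0; have e20 : 0 < e / 2 by rewrite divr_gt0.
have [s hs] := trig_density_real fr e20.
have [t ht] := trig_density_real fi e20.
exists (s ++ tscale 'i%C t).
have cs (s' : seq (int * R[i])) (h : circle R -> R) : haar.-integrable setT (EFin \o h) ->
    cintegrable haar setT (fun z => (h z)%:C - tp s' z).
  move=> ih; apply: cintegrableB => //; last first.
    by apply: ccontinuous_cintegrable; exact: ccontinuous_tp.
  by split => //=; apply: integrable_continuous_circle; exact: cst_continuous.
rewrite [leRHS]splitr (le_trans _ (lerD hs ht))//.
rewrite -RintegralD//; last 2 first.
- by apply: integrable_normc => //; exact: cs.
- by apply: integrable_normc => //; exact: cs.
apply: le_Rintegral => //.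
- apply: integrable_normc => //; apply: cintegrableB => //.
  by apply: ccontinuous_cintegrable; exact: ccontinuous_tp.
- by apply: integrableD_EFin => //; apply: integrable_normc => //; exact: cs.
- move=> z _; rewrite tp_cat tp_scale.
  have -> : nc ((Im (f z))%:C - tp t z) = nc ('i%C * ((Im (f z))%:C - tp t z)).
    by rewrite Normc.normcM /= expr0n /= add0r expr1n sqrtr1 mul1r.
  apply: le_trans (le_normcD _ _).
  rewrite le_eqVlt; apply/orP; left; apply/eqP; congr nc.
  by rewrite {1}(complexE (f z)); ring.
Qed.

(** Beyond the degree of an L^1 approximation by a polynomial, the coefficients of [h] are those of
    the error, which are bounded by its L^1 norm. *)
Lemma riemann_lebesgue_cos (h : circle R -> R) (e : R) : continuous h -> 0 < e ->
  exists N0 : nat, forall N : nat, (N0 < N)%N ->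
    `|\int[haar]_z (h z * Re (chr N z))| <= e.
Proof.
move=> ch e0.
have ih := integrable_continuous_circle ch.
have [s hs] := trig_density_real ih e0.
exists (tdeg s) => N sN.
have ci : ccontinuous (fun z => (h z)%:C) by exact: ccontinuous_real.
have cD : ccontinuous (fun z => (h z)%:C - tp s z).
  by apply: ccontinuousB => //; exact: ccontinuous_tp.
have E : fourier_coef (fun z => (h z)%:C) (- N%:Z) =
    fourier_coef (fun z => (h z)%:C - tp s z) (- N%:Z).
  rewrite fourier_coefB ?fourier_coef_tp//; last exact: ccontinuous_tp.
  by rewrite tdeg_tpc ?subr0//; move: sN; lia.
have -> : \int[haar]_z (h z * Re (chr N z)) = Re (fourier_coef (fun z => (h z)%:C) (- N%:Z)).
  by rewrite fourier_coefE /cint /= opprK; apply: eq_Rintegral => z _; rewrite ReMr.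
by rewrite (le_trans (normc_Re _))// E (le_trans (fourier_coef_le _ _)).
Qed.

End density_theorem.

(** * Riesz products *)

Section riesz_product.
Context {R : realType}.
Local Notation haar := (@haar R).

(** The Taylor coefficient 1/8 is weakened to 1/16, which makes the bound valid on all of [-1, 1].
    The quadratic loss is the source of the decay of the integral of sqrt K. *)
Lemma sqrt1D_le (u : R) : -1 <= u -> u <= 1 ->
  Num.sqrt (1 + u) <= 1 + u / 2 - u ^+ 2 / 16.
Proof.
move=> u1 u2.
have v0 : 0 <= 1 + u / 2 - u ^+ 2 / 16 by nra.
rewrite -(ler_pXn2r (_ : 0 < 2)%N) ?nnegrE ?sqrtr_ge0// sqr_sqrtr; last by lra.
have -> : (1 + u / 2 - u ^+ 2 / 16) ^+ 2 =
    (1 + u) + u ^+ 2 * (1 / 8 - u / 16 + u ^+ 2 / 256) by field.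
by rewrite lerDl mulr_ge0 ?sqr_ge0//; have := sqr_ge0 u; lra.
Qed.

Lemma Re_chr_double (N : int) (z : circle R) :
  Re (chr (N + N) z) = 2 * Re (chr N z) ^+ 2 - 1.
Proof.
rewrite chrD ReM; have := normc_sqr (chr N z); rewrite normc_chr => h.
by nra.
Qed.

Lemma Re_chr_le (N : int) (z : circle R) : `|Re (chr N z)| <= 1.
Proof. by rewrite (le_trans (normc_Re _))// normc_chr. Qed.

Variables (delta : R) (phi : circle R -> R).
Hypotheses (d0 : 0 < delta) (d1 : delta <= 1).
Hypothesis cphi : continuous phi.

(** [K] accompanies its polynomial [k] because the spectral conditions concern [k], while the
    integrals of [phi * K] and of sqrt K require a real nonnegative function. *)
Definition riesz_density (k : seq (int * R[i])) (K : circle R -> R) : Prop :=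
  [/\ forall z, tp k z = (K z)%:C, forall z, 0 <= K z, tpc k 0 = 1 &
      forall n, n != 0 -> nc (tpc k n) <= delta].

Lemma continuous_riesz k K : riesz_density k K -> continuous K.
Proof.
move=> [kK _ _ _]; have [cr _] := ccontinuous_tp k.
by rewrite (_ : K = fun z => Re (tp k z)) //; apply/funext => z; rewrite kK.
Qed.

(** The new factor is 1 + delta * Re (z^N). For large N its oscillation hardly correlates with
    [phi * K] or with sqrt K, so only mean values survive, up to e. In the application [phi] is
    |p|. *)
Lemma riesz_step k K (e : R) : riesz_density k K -> 0 < e ->
  exists k' K', [/\ riesz_density k' K',
    \int[haar]_z (phi z * K' z) <= \int[haar]_z (phi z * K z) + e &
    \int[haar]_z Num.sqrt (K' z) <=
      (1 - delta ^+ 2 / 32) * \int[haar]_z Num.sqrt (K z) + e].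
Proof.
move=> kK e0; have cK := continuous_riesz kK; have [kE K0 k0 kd] := kK.
have cphiK : continuous (fun z => phi z * K z).
  by move=> z; exact: cvgM (@cphi z) (cK z).
have csK : continuous (fun z => Num.sqrt (K z)).
  by move=> z; exact: (continuous_comp (cK z) (@sqrt_continuous _ _)).
have [N1 hN1] := riemann_lebesgue_cos cphiK e0.
have [N2 hN2] := riemann_lebesgue_cos csK e0.
pose D := tdeg k.
(* N passes both Riemann-Lebesgue thresholds and exceeds 2 D, so the translates of the spectrum of K
   by 0, N and -N are disjoint. *)
pose N := (N1 + N2 + D + D).+1.
have NN1 : (N1 < N)%N by rewrite /N; lia.
have NN2 : (N2 < N)%N by rewrite /N; lia.
have NN22 : (N2 < N + N)%N by rewrite /N; lia.
have ND : (D + D < N)%N by rewrite /N; lia.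
pose r : seq (int * R[i]) :=
  [:: (0, 1); (N%:Z, (delta / 2)%:C); (- N%:Z, (delta / 2)%:C)].
pose K' z := K z * (1 + delta * Re (chr N z)).
have rE z : tp r z = (1 + delta * Re (chr N z))%:C.
  rewrite /tp !big_cons big_nil /= chr0 chrNJ mulr1.
  case: (chr N z) => a b; apply: complex_ext => /=.
  - by field.
  - by field.
exists (tmul r k), K'; split.
- split.
  + by move=> z; rewrite tp_mul rE kE /K' mulrC realcM.
  + move=> z; rewrite /K' mulr_ge0//.
    have := Re_chr_le N z; rewrite ler_norml => /andP[h1 h2].
    have : 0 <= delta * (Re (chr N z) + 1) by rewrite mulr_ge0 ?(ltW d0)//; lra.
    by move: d1; lra.
  + rewrite tpc_mul !big_cons big_nil /= subr0 k0 mul1r.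
    by rewrite !tdeg_tpc ?mulr0 ?addr0//; move: ND; rewrite /D; lia.
  + move=> n n0; rewrite tpc_mul !big_cons big_nil /= subr0 mul1r addr0.
    have dh : delta / 2 <= delta by move: d0; lra.
    (* A coefficient of a shifted copy is delta / 2 times a coefficient of [k], possibly the mean 1;
       the latter happens at the frequencies N and -N. *)
    have T m : nc ((delta / 2)%:C * tpc k m) <= delta.
      rewrite Normc.normcM normc_real ger0_norm ?divr_ge0 ?(ltW d0)//.
      rewrite (le_trans _ dh)// ler_piMr ?divr_ge0 ?(ltW d0)//.
      have [->|m0] := eqVneq m 0; first by rewrite k0 Normc.normc1.
      by rewrite (le_trans (kd _ m0)).
    have [nD|nD] := leqP (absz n) D.
      rewrite [tpc k (n - _)]tdeg_tpc; last by move: ND nD; rewrite /D; lia.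
      rewrite [tpc k (n - _)]tdeg_tpc; last by move: ND nD; rewrite /D; lia.
      by rewrite !mulr0 !addr0 kd.
    rewrite [tpc k n]tdeg_tpc// add0r.
    have [np|np] := leP 0 n.
      rewrite [tpc k (n - - _)]tdeg_tpc; last by move: ND nD np; rewrite /D; lia.
      by rewrite mulr0 addr0.
    rewrite [tpc k (n - _)]tdeg_tpc; last by move: ND nD np; rewrite /D; lia.
    by rewrite mulr0 add0r.
- have cc M : continuous (fun z => phi z * K z * Re (chr M z)).
    by move=> z; have [cr _] := @ccontinuous_chr R M; exact: cvgM (cphiK z) (cr z).
  have -> : \int[haar]_z (phi z * K' z) = \int[haar]_z (phi z * K z) +
      delta * \int[haar]_z (phi z * K z * Re (chr N z)).
    rewrite -RintegralZl//; last exact: integrable_continuous_circle.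
    rewrite -RintegralD//.
    - by apply: eq_Rintegral => z _; rewrite /K'; ring.
    - exact: integrable_continuous_circle.
    - by apply: integrableZ_EFin => //; exact: integrable_continuous_circle.
  rewrite lerD2l.
  have := hN1 _ NN1; rewrite ler_norml => /andP[_ h].
  by move: d0 d1 e0 h; nra.
- have cc M : continuous (fun z => Num.sqrt (K z) * Re (chr M z)).
    by move=> z; have [cr _] := @ccontinuous_chr R M; exact: cvgM (csK z) (cr z).
  have icc M : haar.-integrable setT (EFin \o (fun z => Num.sqrt (K z) * Re (chr M z))).
    exact: integrable_continuous_circle.
  have isK : haar.-integrable setT (EFin \o (fun z => Num.sqrt (K z))).
    exact: integrable_continuous_circle.
  have cK' : continuous K'.
    move=> z; have [cr _] := @ccontinuous_chr R N; apply: (cvgM (cK z)).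
    by apply: cvgD; [exact: cvg_cst|apply: cvgM; [exact: cvg_cst|exact: cr]].
  (* In [sqrt1D_le] the squared cosine is (1 + Re (z^(2N))) / 2. Its constant half gives the gain
     delta^2 / 32; what remains oscillates at the frequencies N and 2N. *)
  rewrite (@le_trans _ _ (\int[haar]_z
     ((1 - delta ^+ 2 / 32) * Num.sqrt (K z) +
      ((delta / 2) * (Num.sqrt (K z) * Re (chr N z)) +
       (- (delta ^+ 2 / 32)) * (Num.sqrt (K z) * Re (chr (N + N)%N z))))))//.
    apply: le_Rintegral => //.
    + apply: integrable_continuous_circle => z.
      exact: (continuous_comp (cK' z) (@sqrt_continuous _ _)).
    + apply: integrableD_EFin => //; first exact: integrableZ_EFin.
      by apply: integrableD_EFin => //; exact: integrableZ_EFin.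
    + move=> z _; rewrite /K' sqrtrM//.
      have := Re_chr_le N z; rewrite ler_norml => /andP[h1 h2].
      have dc1 : -1 <= delta * Re (chr N z).
        have : 0 <= delta * (Re (chr N z) + 1) by rewrite mulr_ge0 ?(ltW d0)//; lra.
        by move: d1; lra.
      have dc2 : delta * Re (chr N z) <= 1.
        have : 0 <= delta * (1 - Re (chr N z)) by rewrite mulr_ge0 ?(ltW d0)//; lra.
        by move: d1; lra.
      rewrite (le_trans (ler_wpM2l (sqrtr_ge0 _) (sqrt1D_le dc1 dc2)))//.
      rewrite PoszD Re_chr_double le_eqVlt; apply/orP; left; apply/eqP.
      by field.
  rewrite RintegralD//; last 2 first.
  + exact: integrableZ_EFin.
  + by apply: integrableD_EFin => //; exact: integrableZ_EFin.
  rewrite RintegralD//; last 2 first.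
  + exact: integrableZ_EFin.
  + exact: integrableZ_EFin.
  rewrite !RintegralZl// lerD2l.
  have := hN2 _ NN2; have := hN2 _ NN22; rewrite !ler_norml => /andP[a1 a2] /andP[b1 b2].
  set u := \int[haar]_z (Num.sqrt (K z) * Re (chr N z)) in b1 b2 *.
  set v := \int[haar]_z (Num.sqrt (K z) * Re (chr (N + N)%N z)) in a1 a2 *.
  have dd1 : delta ^+ 2 <= 1 by rewrite expr_le1// ltW.
  have dd0 : 0 <= delta ^+ 2 by rewrite sqr_ge0.
  have p1 : (delta / 2) * u <= (delta / 2) * e.
    by rewrite ler_wpM2l// divr_ge0// ltW.
  have p2 : - (delta ^+ 2 / 32) * v <= (delta ^+ 2 / 32) * e.
    by rewrite mulNr -mulrN ler_wpM2l// ?divr_ge0//; lra.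
  rewrite (le_trans (lerD p1 p2))// -mulrDl ler_piMl ?(ltW e0)//.
  by move: d1 dd1; lra.
Qed.

Lemma riesz_iter (J : nat) (e : R) : 0 < e ->
  exists k K, [/\ riesz_density k K,
    \int[haar]_z (phi z * K z) <= \int[haar]_z phi z + e &
    \int[haar]_z Num.sqrt (K z) <= (1 - delta ^+ 2 / 32) ^+ J + e].
Proof.
elim: J e => [|J ih] e e0.
  exists [:: (0, 1)], (fun=> 1); split.
  - split=> //.
    + by move=> z; rewrite /tp big_seq1 /= chr0 mulr1.
    + by rewrite /tpc big_cons big_nil /= addr0.
    + move=> n n0; rewrite /tpc big_cons big_nil /= eq_sym (negbTE n0).
      by rewrite Normc.normc0 ltW.
  - under eq_Rintegral do rewrite mulr1.
    by rewrite lerDl ltW.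
  - rewrite Rintegral_cst//= haar_setT /= mulr1 sqrtr1 lerDl ltW//.
have e20 : 0 < e / 2 by rewrite divr_gt0.
have [k [K [kK phiK sK]]] := ih _ e20.
have [k' [K' [kK' phiK' sK']]] := riesz_step kK e20.
exists k', K'; split => //; first by lra.
have q0 : 0 <= 1 - delta ^+ 2 / 32.
  by have : delta ^+ 2 <= 1 by [rewrite expr_le1// ltW]; lra.
have q1 : 1 - delta ^+ 2 / 32 <= 1.
  by have := sqr_ge0 delta; lra.
move: q0 q1 sK sK'; rewrite exprS; move: (1 - _) => q q0 q1 sK sK'.
rewrite (le_trans sK')// [in leRHS](splitr e) addrA lerD2r.
rewrite (le_trans (ler_wpM2l q0 sK))// mulrDr -exprS lerD2l.
by rewrite ler_piMl// ltW.
Qed.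

(** However small [delta] is, the powers of 1 - delta^2 / 32 tend to 0, so enough factors
    concentrate the product. *)
Lemma riesz_product (e : R) : 0 < e ->
  exists k K, [/\ riesz_density k K,
    \int[haar]_z (phi z * K z) <= \int[haar]_z phi z + e &
    \int[haar]_z Num.sqrt (K z) <= e].
Proof.
move=> e0; have e20 : 0 < e / 2 by rewrite divr_gt0.
have dd1 : delta ^+ 2 <= 1 by rewrite expr_le1// ltW.
have dd0 : 0 < delta ^+ 2 by rewrite exprn_gt0.
have : (1 - delta ^+ 2 / 32) ^+ J @[J --> \oo] --> 0.
  by apply: cvg_expr; rewrite ger0_norm; lra.
move=> /cvgr0Pnorm_le /(_ _ e20)[J _ /(_ J (leqnn J))] /= hJ.
have [k [K [kK phiK sK]]] := riesz_iter J e20.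
exists k, K; split => //; first by lra.
by move: hJ; rewrite ler_norml => /andP[_ hJ]; lra.
Qed.

End riesz_product.

(** * The Sidon inequality *)

Section geometric_limits.
Context {R : realType}.

(** 9/8 * 9^(-k) is the tail from k on of the geometric series of ratio 1/9, so the intervals of
    this radius around [u k] are nested; the limit is the supremum of their left ends. *)
Lemma geometric_cauchy_limit (u : nat -> R) :
  (forall k, `|u k.+1 - u k| <= 9^-1 ^+ k) ->
  exists l, forall k, `|l - u k| <= 9 / 8 * 9^-1 ^+ k.
Proof.
move=> du.
have c0 k : 0 <= (9^-1 : R) ^+ k by rewrite exprn_ge0.
pose v k := u k - 9 / 8 * 9^-1 ^+ k; pose w k := u k + 9 / 8 * 9^-1 ^+ k.
have vw k : v k <= w k by rewrite /v /w; have := c0 k; lra.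
have vm k : v k <= v k.+1.
  have := du k; rewrite ler_norml /v exprS => /andP[h _].
  by move: h; set c := 9^-1 ^+ k; lra.
have wm k : w k.+1 <= w k.
  have := du k; rewrite ler_norml /w exprS => /andP[_ h].
  by move: h; set c := 9^-1 ^+ k; lra.
have vn : {homo v : i j / (i <= j)%N >-> i <= j}.
  exact/(homo_leq (r := fun x y => x <= y) lexx le_trans).
have wn : {homo w : i j / (i <= j)%N >-> j <= i}.
  apply: (homo_leq (r := fun x y => y <= x) lexx) => // x y z xy yz.
  exact: le_trans yz xy.
have vw2 i j : v i <= w j.
  rewrite (le_trans (vn _ _ (leq_maxl i j)))// (le_trans (vw _))//.
  exact/wn/leq_maxr.
have hs : has_sup (range v).
  by split; [exists (v 0%N), 0%N|exists (w 0%N) => _ [k _ <-]].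
exists (sup (range v)) => k.
have h1 : v k <= sup (range v) by apply: sup_upper_bound => //; exists k.
have h2 : sup (range v) <= w k.
  by apply: ge_sup; [case: hs|move=> _ [i _ <-]].
by rewrite ler_norml; move: h1 h2; rewrite /v /w => h1 h2; apply/andP; split; lra.
Qed.

Lemma uniform_limit_real (T : topologicalType) (g : nat -> T -> R) (f : T -> R)
    (b : nat -> R) : (forall k, continuous (g k)) ->
  (forall k x, `|f x - g k x| <= b k) -> b k @[k --> \oo] --> 0 ->
  continuous f.
Proof.
move=> cg fg b0 x; apply/cvgrPdist_lt => e e0.
have e30 : 0 < e / 3 by rewrite divr_gt0.
have [k _ /(_ k (leqnn k)) bk] := (cvgr0Pnorm_lt _).1 b0 _ e30.
have hk : b k < e / 3 by rewrite (le_lt_trans (ler_norm _)).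
near=> y.
have gxy : `|g k x - g k y| < e / 3.
  by near: y; apply: cvgr_dist_lt => //; exact: cg.
have -> : f x - f y = (f x - g k x) + (g k x - g k y) - (f y - g k y) by ring.
rewrite (le_lt_trans (ler_normB _ _))//.
rewrite (@le_lt_trans _ _ (`|f x - g k x| + `|g k x - g k y| + `|f y - g k y|))//.
  by rewrite lerD2r ler_normD.
have := fg k x; have := fg k y; lra.
Unshelve. all: by end_near. Qed.

Lemma exprV9_cvg0 : (9^-1 : R) ^+ k @[k --> \oo] --> 0.
Proof. by apply: cvg_expr; rewrite ger0_norm; lra. Qed.

End geometric_limits.

Section sidon_inequality.
Context {R : realType}.
Variable L : set int.

Definition spectral (f : circle R -> R[i]) : Prop :=
  ccontinuous f /\ forall n, ~ L n -> fourier_coef f n = 0.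

Definition coef_sum (D : nat) (f : circle R -> R[i]) : R :=
  \sum_(i < (D + D).+1) nc (fourier_coef f (freq i)).

Lemma spectralD f g : spectral f -> spectral g -> spectral (fun z => f z + g z).
Proof.
move=> [cf f0] [cg g0]; split; first exact: ccontinuousD.
by move=> n nL; rewrite fourier_coefD// f0// g0// addr0.
Qed.

Lemma spectralZ c f : spectral f -> spectral (fun z => c * f z).
Proof.
move=> [cf f0]; split.
  by apply: ccontinuousM => //; exact: ccontinuous_cst.
by move=> n nL; rewrite fourier_coefZ// f0// mulr0.
Qed.

Lemma spectralB f g : spectral f -> spectral g -> spectral (fun z => f z - g z).
Proof.
move=> [cf f0] [cg g0]; split; first exact: ccontinuousB.
by move=> n nL; rewrite fourier_coefB// f0// g0// subr0.
Qed.

Lemma coef_sum_ge0 D f : 0 <= coef_sum D f.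
Proof. by apply: sumr_ge0 => i _; exact: normc_ge0. Qed.

Lemma coef_sumD D f g : ccontinuous f -> ccontinuous g ->
  coef_sum D (fun z => f z + g z) <= coef_sum D f + coef_sum D g.
Proof.
move=> cf cg; rewrite -big_split/=; apply: ler_sum => i _.
by rewrite fourier_coefD// le_normcD.
Qed.

Lemma coef_sumB D f g : ccontinuous f -> ccontinuous g ->
  coef_sum D (fun z => f z - g z) <= coef_sum D f + coef_sum D g.
Proof.
move=> cf cg; rewrite -big_split/=; apply: ler_sum => i _.
by rewrite fourier_coefB// (le_trans (le_normcD _ _))// normcN.
Qed.

Lemma coef_sumZ D c f : ccontinuous f ->
  coef_sum D (fun z => c * f z) = nc c * coef_sum D f.
Proof.
move=> cf; rewrite mulr_sumr; apply: eq_bigr => i _.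
by rewrite fourier_coefZ// Normc.normcM.
Qed.

Lemma coef_sum_sup D f B : ccontinuous f -> (forall z, nc (f z) <= B) ->
  coef_sum D f <= B *+ (D + D).+1.
Proof.
move=> cf fB.
have -> : B *+ (D + D).+1 = \sum_(i < (D + D).+1) B.
  by rewrite sumr_const card_ord.
by apply: ler_sum => i _; exact: fourier_coef_sup.
Qed.

Lemma coef_sum_esum D f :
  ((coef_sum D f)%:E <=
   \esum_(n in [set: int]) (nc (fourier_coef f n))%:E)%E.
Proof.
pose r := [seq freq i | i <- enum 'I_(D + D).+1].
have ur : uniq r by rewrite map_inj_uniq ?enum_uniq//; exact: freq_inj.
apply: esum_ge; exists [set` r]; first by split => //; exact: finite_seq.
rewrite -fsbig_seq// big_map big_enum/= /coef_sum.
by rewrite sumEFin.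
Qed.

(* Gliding hump, after Sokal: the sign of the k-th hump is chosen so that adding it
   does not decrease the coefficient sum at which it nearly attains the norm. *)
Lemma sidon_bounded : sidon R L -> exists C, forall f, spectral f ->
  (forall z, nc (f z) <= 1) -> forall D, coef_sum D f <= C.
Proof.
move=> sL; apply: contrapT => /forallNP noC.
have unb C : exists D f, [/\ spectral f, forall z, nc (f z) <= 1 & C < coef_sum D f].
  apply: contrapT => H; apply: (noC C) => f sf f1 D; rewrite leNgt.
  by apply/negP => h; apply: H; exists D, f.
have hump k : exists Df : nat * (circle R -> R[i]),
    [/\ spectral Df.2, forall z, nc (Df.2 z) <= 1,
      9 ^+ k * k%:R <= coef_sum Df.1 Df.2 &
      forall g, spectral g -> (forall z, nc (g z) <= 1) ->
        coef_sum Df.1 g <= 4 / 3 * coef_sum Df.1 Df.2].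
  (* For fixed D the supremum over the unit ball is finite. The factor 4/3 leaves room to replace f
     by some g that reaches three quarters of this supremum. *)
  have [D [f [sf f1 fD]]] := unb (4 / 3 * (9 ^+ k * k%:R)).
  pose E := [set coef_sum D g | g in [set g | spectral g /\ forall z, nc (g z) <= 1]].
  have Ef : E (coef_sum D f) by exists f.
  have hE : has_sup E.
    split; first by exists (coef_sum D f).
    exists (1 *+ (D + D).+1) => _ [g [[cg _] g1] <-].
    exact: coef_sum_sup.
  have p0 : 0 <= (9 : R) ^+ k * k%:R by rewrite mulr_ge0// exprn_ge0.
  have fs : coef_sum D f <= sup E by apply: sup_upper_bound.
  have s0 : 0 < sup E / 4 by move: fs fD p0; lra.
  have [_ [g [sg g1] <-] hg] := sup_adherent s0 hE.
  exists (D, g); split => //=.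
    by move: hg fs fD; lra.
  move=> h sh h1; have hh : coef_sum D h <= sup E.
    by apply: sup_upper_bound => //; exists h.
  by move: hg hh; lra.
have [Df hDf] := choice hump.
pose D k := (Df k).1; pose f k := (Df k).2; pose c k : R := 9^-1 ^+ k.
have c0 k : 0 <= c k by rewrite exprn_ge0.
pose fix x k : circle R -> R[i] := if k is j.+1 then
    let y := fun z => x j z + (c j)%:C * f j z in
    if c j * coef_sum (D j) (f j) <= coef_sum (D j) y then y
    else fun z => x j z - (c j)%:C * f j z
  else fun=> 0.
have sf k : spectral (f k) by have [h _ _ _] := hDf k; exact: h.
have f1 k z : nc (f k z) <= 1 by have [_ h _ _] := hDf k; exact: h.
have sx k : spectral (x k).
  elim: k => [|k ih] /=.
    split=> [|n _]; first exact: ccontinuous_cst.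
    by rewrite (_ : (fun=> 0) = fun z => 0 * chr 0 z) ?fourier_coefZ ?mul0r//;
      [exact: ccontinuous_chr|apply/funext => z; rewrite mul0r].
  by case: ifP => _; [apply: spectralD|apply: spectralB] => //; exact: spectralZ.
have xstep k z : nc (x k.+1 z - x k z) <= c k.
  have h : nc ((c k)%:C * f k z) <= c k.
    by rewrite Normc.normcM normc_real ger0_norm// ler_piMr.
  rewrite /=; case: ifP => _; first by rewrite addrAC subrr add0r.
  by rewrite addrAC subrr add0r normcN.
(* The two candidates for [x k.+1] differ by twice the scaled hump, so by subadditivity at least one
   of them has the required coefficient sum. *)
have xbig k : c k * coef_sum (D k) (f k) <= coef_sum (D k) (x k.+1).
  rewrite /=; case: ifPn => //; rewrite -ltNge => hlt.
  have [cx _] := sx k; have [cf _] := sf k.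
  have ccf : ccontinuous (fun z => (c k)%:C * f k z).
    by apply: ccontinuousM => //; exact: ccontinuous_cst.
  have h := @coef_sumB (D k) (fun z => x k z + (c k)%:C * f k z)
    (fun z => x k z - (c k)%:C * f k z) (ccontinuousD cx ccf) (ccontinuousB cx ccf).
  have e : coef_sum (D k) (fun z => x k z + (c k)%:C * f k z -
      (x k z - (c k)%:C * f k z)) = 2 * (c k * coef_sum (D k) (f k)).
    rewrite (_ : (fun z => _) = fun z => (2 * c k)%:C * f k z).
      by rewrite coef_sumZ// normc_real ger0_norm ?mulr_ge0// mulrA.
    by apply/funext => z; rewrite rmorphM rmorph_nat; ring.
  by move: h hlt; rewrite e; lra.
have xr z : exists l, forall k, `|l - Re (x k z)| <= 9 / 8 * 9^-1 ^+ k.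
  apply: geometric_cauchy_limit => k; rewrite -ReB.
  by rewrite (le_trans (normc_Re _)).
have xi z : exists l, forall k, `|l - Im (x k z)| <= 9 / 8 * 9^-1 ^+ k.
  apply: geometric_cauchy_limit => k; rewrite -ImB.
  by rewrite (le_trans (normc_Im _)).
have [yr hyr] := choice xr; have [yi hyi] := choice xi.
pose y z := yr z +i* yi z.
have b0 : 9 / 8 * (9^-1 : R) ^+ k @[k --> \oo] --> 0.
  rewrite -[X in _ --> X](mulr0 (9 / 8)).
  by apply: cvgM; [exact: cvg_cst|exact: exprV9_cvg0].
have cy : ccontinuous y.
  split => /=.
  - apply: (@uniform_limit_real _ _ (fun k z => Re (x k z)) _ _ _ _ b0) => [k|k z] //.
    by have [[]] := sx k.
  - apply: (@uniform_limit_real _ _ (fun k z => Im (x k z)) _ _ _ _ b0) => [k|k z] //.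
    by have [[]] := sx k.
have yx k z : nc (y z - x k z) <= 9 / 4 * c k.
  rewrite (le_trans (normc_le_abs _))// ReB ImB /=.
  by rewrite (le_trans (lerD (hyr z k) (hyi z k)))// -/(c k); have := c0 k; lra.
have sy : spectral y.
  split=> // n nL; apply: Normc.eq0_normc.
  have h k : nc (fourier_coef y n) <= 9 / 4 * c k.
    have [cx x0] := sx k.
    rewrite -[fourier_coef y n]subr0 -(x0 _ nL) -fourier_coefB//.
    by apply: fourier_coef_sup => //; exact: ccontinuousB.
  apply/eqP; rewrite eq_le normc_ge0 andbT.
  apply/ler_addgt0Pl => e e0; rewrite addr0.
  have [k _ /(_ k (leqnn k)) ck] := (cvgr0Pnorm_lt _).1 exprV9_cvg0 (e / 3)
    (divr_gt0 e0 (ltr0n R 3)).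
  have := h k; have : c k < e / 3 by rewrite (le_lt_trans (ler_norm _)).
  lra.
(* The later humps add up to at most 9/4 * c (k+1) = c k / 4 in sup norm. As [f k] nearly attains
   the norm, their coefficient sum is at most a third of that of the k-th scaled hump, and two
   thirds survive. The ratio 9 is chosen for this. *)
have ybig k : 2 / 3 * k%:R <= coef_sum (D k) y.
  have [_ _ fk gk] := hDf k; rewrite -/(D k) -/(f k) in fk gk.
  have [cx _] := sx k.+1.
  have ck0 : 0 < c k by rewrite exprn_gt0.
  have small : coef_sum (D k) (fun z => x k.+1 z - y z) <=
      c k / 4 * (4 / 3 * coef_sum (D k) (f k)).
    pose g z := (4 / c k)%:C * (x k.+1 z - y z).
    have sg : spectral g by apply: spectralZ; exact: spectralB.
    have g1 z : nc (g z) <= 1.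
      rewrite Normc.normcM normc_real ger0_norm ?divr_ge0// normc_sub.
      rewrite mulrAC ler_pdivrMr// mul1r.
      have := yx k.+1 z; rewrite {1}/c exprS -/(c k) => h.
      by move: h; lra.
    have := gk _ sg g1; rewrite coef_sumZ; last exact: ccontinuousB.
    rewrite normc_real ger0_norm ?divr_ge0// => h.
    rewrite -[leLHS](@mulKf _ (4 / c k)) ?gt_eqF ?divr_gt0//.
    rewrite invf_div ler_wpM2l// divr_ge0//.
  have h := @coef_sumD (D k) (fun z => x k.+1 z - y z) y (ccontinuousB cx cy) cy.
  have e : coef_sum (D k) (fun z => x k.+1 z - y z + y z) = coef_sum (D k) (x k.+1).
    by congr coef_sum; apply/funext => z; rewrite subrK.
  rewrite e in h; have xb := xbig k.
  have fk' : k%:R <= c k * coef_sum (D k) (f k).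
    have := ler_wpM2l (c0 k) fk.
    by rewrite mulrA /c exprVn mulVf ?expf_neq0// mul1r.
  by move: small h xb fk'; set a := coef_sum _ (f k); set b := c k; nra.
have [/ccontinuousP cy' y0] := sy.
have fin := sL y cy' y0.
set S := esum _ _ in fin.
have S0 : (0 <= S)%E by apply: esum_ge0 => n _; rewrite lee_fin normc_ge0.
have Sfin : S \is a fin_num by rewrite ge0_fin_numE.
have yS k : 2 / 3 * k%:R <= fine S.
  rewrite (le_trans (ybig k))// -lee_fin fineK//; exact: coef_sum_esum.
have := yS (Num.truncn (3 / 2 * fine S)).+1.
have := truncnS_gt (3 / 2 * fine S).
lra.
Qed.

Lemma sidon_inequality : sidon R L -> exists C, 0 < C /\ forall f, spectral f ->
  forall B, (forall z, nc (f z) <= B) -> forall D, coef_sum D f <= C * B.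
Proof.
move=> /sidon_bounded [C HC]; exists (`|C| + 1); split; first by rewrite ltr_wpDl.
move=> f sf B fB D.
have [cf _] := sf.
have B0 : 0 <= B by rewrite (le_trans _ (fB (circle_exp 0)))// normc_ge0.
have [B0'|Bn0] := eqVneq B 0.
  by have := coef_sum_sup D cf fB; rewrite B0' mulr0 mul0rn.
have Bp : 0 < B by rewrite lt_def Bn0.
have f1 z : nc ((B^-1)%:C * f z) <= 1.
  by rewrite Normc.normcM normc_real ger0_norm ?invr_ge0// ler_pdivrMl ?mulr1.
have := HC _ (spectralZ (B^-1)%:C sf) f1 D.
rewrite coef_sumZ// normc_real ger0_norm ?invr_ge0// => H.
rewrite mulrC -ler_pdivrMl// (le_trans H)//.
by rewrite (le_trans (ler_norm _))// lerDl.
Qed.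

End sidon_inequality.

(** * Interpolation on a Sidon set by small polynomials *)

Section separation.
Context {R : realType} {I : finType}.
Implicit Types (c v w d : I -> R[i]).

(** The inner product of C^I as a real space, that is the real part of the sum of
    [conjc (c i) * v i]; every real linear functional has this form. *)
Definition rdot c v : R := \sum_i (Re (c i) * Re (v i) + Im (c i) * Im (v i)).

Definition sqdist v w : R := \sum_i nc (v i - w i) ^+ 2.

(* A point which no real linear functional separates from a bounded convex set
   is in its closure: the gradient of the squared distance at a near minimiser
   would be a separating functional. *)
Lemma convex_approx (B : set (I -> R[i])) d (b : R) : B !=set0 ->
  (forall v w, B v -> B w -> forall s, 0 <= s <= 1 ->
    B (fun i => v i + s%:C * (w i - v i))) ->
  (forall v i, B v -> nc (v i) <= b) ->
  (forall c, exists2 v, B v & rdot c d <= rdot c v) ->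
  forall e, 0 < e -> exists2 v, B v & sqdist v d <= e.
Proof.
move=> [v0 Bv0] convB boundB sepB e e0.
apply: contrapT => noB.
have far v : B v -> e < sqdist v d.
  by move=> Bv; rewrite ltNge; apply/negP => h; apply: noB; exists v.
pose E := [set sqdist v d | v in B].
have hE : has_inf E.
  split; first by exists (sqdist v0 d), v0.
  by exists e => _ [v Bv <-]; exact/ltW/far.
pose K : R := (2 * b) ^+ 2 *+ #|I| + 1.
have K0 : 0 < K by rewrite ltr_wpDl// mulrn_wge0// sqr_ge0.
(* A step of length s from v towards w lowers the squared distance by more than 2 s e to first
   order. K bounds the squared diameter, so the quadratic term costs at most s e, and the net gain
   exceeds the slack s e / 2 of the near minimiser. *)
pose s : R := Num.min 1 (e / K).
have s0 : 0 < s by rewrite lt_min ltr01 divr_gt0.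
have s1 : s <= 1 by rewrite ge_min lexx.
have sK : s * K <= e.
  by rewrite -ler_pdivlMr// ge_min lexx orbT.
have t0 : 0 < s * e / 2 by rewrite divr_gt0// mulr_gt0.
have [_ [v Bv <-] hv] := inf_adherent t0 hE.
have [w Bw hw] := sepB (fun i => d i - v i).
have s01 : 0 <= s <= 1 by rewrite ltW.
have h1 : inf E <= sqdist (fun i => v i + s%:C * (w i - v i)) d.
  by apply: inf_lbound; [case: hE|exists (fun i => v i + s%:C * (w i - v i)); [exact: convB|]].
have E1 : sqdist (fun i => v i + s%:C * (w i - v i)) d =
    sqdist v d - 2 * s * (rdot (fun i => d i - v i) w - rdot (fun i => d i - v i) v)
    + s ^+ 2 * sqdist w v.
  rewrite /sqdist /rdot -sumrB !mulr_sumr -sumrB -big_split/=.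
  apply: eq_bigr => i _; rewrite !normc_sqr !(ReB, ImB, ReD, ImD, ReMr, ImMr).
  ring.
have E2 : rdot (fun i => d i - v i) d - rdot (fun i => d i - v i) v = sqdist v d.
  rewrite /sqdist /rdot -sumrB; apply: eq_bigr => i _.
  by rewrite !normc_sqr !(ReB, ImB); ring.
have h2 : sqdist w v <= K.
  rewrite /K -[leLHS]addr0 lerD// -sumr_const; apply: ler_sum => i _.
  rewrite ler_pXn2r ?nnegrE ?normc_ge0//.
    by rewrite mulr_natl mulr2n ler_normcD// ?normcN boundB.
  by rewrite mulr_ge0// (le_trans (normc_ge0 _) (boundB v i Bv)).
have h3 := far _ Bv.
have h4 : s ^+ 2 * sqdist w v <= s * e.
  rewrite expr2 -mulrA ler_pM2l// (le_trans _ sK)// ler_pM2l//.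
rewrite E1 in h1.
have h5 : s * e < s * (rdot (fun i => d i - v i) w - rdot (fun i => d i - v i) v).
  by rewrite ltr_pM2l//; move: hw h3; rewrite -E2; lra.
by move: h1 hv h4 h5; rewrite -[2 * s * _]mulrA; lra.
Qed.

End separation.

Section correction.
Context {R : realType}.
Local Notation haar := (@haar R).
Variable L : set int.

Lemma Rintegral_nc_tpD (s t : seq (int * R[i])) :
  \int[haar]_z nc (tp (s ++ t) z) <=
  \int[haar]_z nc (tp s z) + \int[haar]_z nc (tp t z).
Proof.
have i1 u : haar.-integrable setT (EFin \o (fun z => nc (tp u z))).
  by apply: integrable_continuous_circle; apply: continuous_normc; exact: ccontinuous_tp.
rewrite -RintegralD//; apply: le_Rintegral => //.
  by apply: integrableD_EFin.
by move=> z _; rewrite tp_cat le_normcD.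
Qed.

Lemma Rintegral_nc_tpZ (c : R[i]) (s : seq (int * R[i])) :
  \int[haar]_z nc (tp (tscale c s) z) = nc c * \int[haar]_z nc (tp s z).
Proof.
rewrite -RintegralZl//.
  by apply: eq_Rintegral => z _; rewrite tp_scale Normc.normcM.
by apply: integrable_continuous_circle; apply: continuous_normc; exact: ccontinuous_tp.
Qed.

Lemma tpc_le (s : seq (int * R[i])) n :
  nc (tpc s n) <= \int[haar]_z nc (tp s z).
Proof. by rewrite -fourier_coef_tp fourier_coef_le//; exact: ccontinuous_tp. Qed.

(** In 4 C + 1, one factor 2 pays for the damping of the coefficients by the kernel, the other for a
    strict inequality in the choice of the point x. The summand 1 pays for passing from the closure,
    which is all that convexity gives, to exact interpolation. *)
Lemma sidon_correction : sidon R L -> exists C, 0 < C /\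
  forall (s : seq (int * R[i])) (delta : R), 0 < delta ->
    (forall n, L n -> nc (tpc s n) <= delta) ->
  exists r, (forall n, L n -> tpc r n = tpc s n) /\
    \int[haar]_z nc (tp r z) <= C * delta.
Proof.
move=> /sidon_inequality [C [C0 HC]].
exists (4 * C + 1); split; first by lra.
move=> s delta d0 sd.
(* M exceeds 2 D^2, so by [kerc_bounds] the kernel keeps at least half of every coefficient up to
   degree D. *)
pose D := tdeg s; pose M := (D + D * D + D * D).+1.
have DM : (D <= M)%N by rewrite /M; lia.
pose inL n : bool := `[< L n >].
pose A := 4 * C * delta.
have A0 : 0 < A by rewrite /A !mulr_gt0.
pose co (r : seq (int * R[i])) (i : 'I_(M + M).+1) : R[i] :=
  if inL (freq i) then tpc r (freq i) else 0.
pose P r := (forall n, (M < absz n)%N -> tpc r n = 0) /\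
  \int[haar]_z nc (tp r z) <= A.
pose B : set ('I_(M + M).+1 -> R[i]) := [set co r | r in [set r | P r]].
have P0 : P [::].
  split=> [n _|]; first by rewrite /tpc big_nil.
  under eq_Rintegral do rewrite /tp big_nil Normc.normc0.
  by rewrite Rintegral_cst// mul0r ltW.
have Bne : B !=set0 by exists (co [::]), [::].
have coD r t i : co (r ++ t) i = co r i + co t i.
  by rewrite /co; case: ifP => _; rewrite ?addr0// tpc_cat.
have coZ c r i : co (tscale c r) i = c * co r i.
  by rewrite /co; case: ifP => _; rewrite ?mulr0// tpc_scale.
have convB v w : B v -> B w -> forall t, 0 <= t <= 1 ->
    B (fun i => v i + t%:C * (w i - v i)).
  move=> [r [r0 rA] <-] [q [q0 qA] <-] t /andP[t0 t1].
  exists (tscale (1 - t)%:C r ++ tscale t%:C q).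
    split=> [n Mn|]; first by rewrite tpc_cat !tpc_scale r0// q0// !mulr0 addr0.
    rewrite (le_trans (Rintegral_nc_tpD _ _))// !Rintegral_nc_tpZ !normc_real.
    rewrite !ger0_norm ?subr_ge0//.
    have -> : A = (1 - t) * A + t * A by ring.
    by rewrite lerD// ler_wpM2l// subr_ge0.
  apply/funext => i; rewrite coD !coZ rmorphB/= rmorph1; ring.
have boundB v i : B v -> nc (v i) <= A.
  move=> [r [_ rA] <-]; rewrite /co; case: ifP => _.
    exact: le_trans (tpc_le _ _) rA.
  by rewrite Normc.normc0 ltW.
have kb n : (absz n <= M)%N -> 0 <= (kerc M n : R) by move=> _; rewrite divr_ge0.
have khalf n : (absz n <= D)%N -> 2^-1 <= (kerc M n : R).
  move=> nD; have /andP[+ _] := @kerc_bounds R M n isT (leq_trans nD DM).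
  apply: le_trans.
  have h : ((absz n * absz n)%N%:R : R) / M%:R <= 2^-1.
    rewrite ler_pdivrMr// mulrC ler_pdivlMr// -natrM ler_nat.
    have : (absz n * absz n <= D * D)%N by rewrite leq_mul.
    by rewrite /M; lia.
  by move: h; lra.
have sepB c : exists2 v, B v & rdot c (co s) <= rdot c v.
  pose a (i : 'I_(M + M).+1) : R[i] := if inL (freq i) then c i else 0.
  (* The functional c, cut down to L and damped by the kernel, becomes a polynomial with spectrum in
     L; [inord] inverts [freq]. Pairing c with the kernel at x, restricted to L, amounts to
     evaluating g at x. *)
  pose g := tfreq M (fun n => ((kerc M n : R))%:C * a (inord (absz (n + M%:Z)%R))).
  have ai (i : 'I_(M + M).+1) : a (inord (absz (freq i + M%:Z)%R)) = a i.
    by rewrite /freq subrK absz_nat inord_val.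
  have sg : spectral L (tp g).
    split; first exact: ccontinuous_tp.
    move=> n nL; rewrite fourier_coef_tp tpc_freq; case: ifPn => // /freq_surj[i iE].
    by rewrite -iE ai /a iE (_ : inL n = false) ?mulr0//; exact/asboolPn.
  have kpos (i : 'I_(M + M).+1) : 0 <= (kerc M (freq i) : R).
    by apply: kb; exact: freq_le.
  pose T := coef_sum M (tp g).
  have TE : T = \sum_(i < (M + M).+1) kerc M (freq i) * nc (a i).
    apply: eq_bigr => i _; rewrite fourier_coef_tp tpc_freq freq_le ai.
    by rewrite Normc.normcM normc_real ger0_norm.
  have hd : rdot c (co s) <= 2 * delta * T.
    rewrite TE mulr_sumr; apply: ler_sum => i _.
    rewrite (le_trans (Re_mul_le _ _))// /co /a; case: ifPn => [/asboolP Li|_]; last first.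
      by rewrite Normc.normc0 !mulr0.
    have [iD|iD] := leqP (absz (freq i)) D; last first.
      by rewrite tdeg_tpc// Normc.normc0 mulr0 !mulr_ge0 ?normc_ge0 ?(ltW d0).
    rewrite (le_trans (ler_wpM2l (normc_ge0 _) (sd _ Li)))//.
    rewrite [leRHS]mulrA [leRHS]mulrC ler_wpM2l ?normc_ge0//.
    have := ler_wpM2l (ltW d0) (khalf _ iD).
    by rewrite -[2 * delta * _]mulrA; lra.
  have [T0|Tn0] := eqVneq T 0.
    exists (co [::]); first by exists [::].
    rewrite (le_trans hd)// T0 mulr0; apply: sumr_ge0 => i _.
    by rewrite /co /tpc big_nil if_same /= !mulr0 addr0.
  have Tp : 0 < T by rewrite lt_def Tn0 coef_sum_ge0.
  (* Otherwise the Sidon inequality would give T <= T / 2. *)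
  have [x hx] : exists x, T / (2 * C) < nc (tp g x).
    apply: contrapT => H.
    have h z : nc (tp g z) <= T / (2 * C).
      by rewrite leNgt; apply/negP => h; apply: H; exists z.
    have := HC _ sg _ h M; rewrite -/T.
    have -> : C * (T / (2 * C)) = T / 2 by field; rewrite gt_eqF.
    by move: Tp; lra.
  set G := tp g x in hx.
  have G0 : 0 < nc G by rewrite (le_lt_trans _ hx)// divr_ge0 ?mulr_ge0// ltW.
  (* The phase of [om] makes the pairing equal to A * |G|, which exceeds A * T / (2 C) = 2 delta T;
     its modulus A is the L^1 norm of [om] times the kernel, whose mean is 1. *)
  pose om := (A / nc G)%:C * G.
  have nom : nc om = A.
    by rewrite Normc.normcM normc_real ger0_norm ?divr_ge0 ?(ltW A0) ?(ltW G0)// divfK// gt_eqF.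
  exists (co (tscale om (kers M x))).
    exists (tscale om (kers M x)) => //; split=> [n Mn|].
      by rewrite tpc_scale tpc_kers leqNgt Mn mulr0.
    rewrite Rintegral_nc_tpZ nom.
    have -> : \int[haar]_z nc (tp (kers M x) z) = \int[haar]_z ker M z x.
      by apply: eq_Rintegral => z _; rewrite ker_sum normc_real ger0_norm// ker_ge0.
    by rewrite integral_ker mulr1.
  have -> : rdot c (co (tscale om (kers M x))) = Re (conjc om * G).
    rewrite /G tp_freq mulr_sumr Re_sum; apply: eq_bigr => i _.
    rewrite ai /co /a tpc_scale tpc_kers freq_le; case: ifPn => _; last first.
      by rewrite !(mulr0, mul0r) addr0.
    rewrite chrNJ; move: (kerc _ _) => k; case: (chr _ _) => u u'.
    by case: (c i) => v v'; case: om {nom} => o o' /=; ring.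
  have -> : conjc om * G = (A * nc G)%:C.
    rewrite /om; have -> : conjc ((A / nc G)%:C * G) * G = (A / nc G)%:C * (G * conjc G).
      by case: (G) => u u'; apply: complex_ext => /=; ring.
    by rewrite mulr_conj -rmorphM/=; congr (_%:C); field; rewrite gt_eqF.
  rewrite /= (le_trans hd)//.
  have := ler_wpM2l (ltW A0) (ltW hx); apply: le_trans.
  by rewrite /A le_eqVlt; apply/orP; left; apply/eqP; field; rewrite gt_eqF.
(* The coefficients that are still wrong, at 2M + 1 frequencies at most, are repaired by [q]; with
   error [kap] each they cost [delta] in total. *)
pose kap : R := delta / (M + M).+1%:R.
have kap0 : 0 < kap by rewrite divr_gt0.
have [_ [r [r0 rA] <-] hv] := convex_approx Bne convB boundB sepB (exprn_gt0 2 kap0).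
have small i : nc (co r i - co s i) <= kap.
  rewrite -(ler_pXn2r (_ : 0 < 2)%N) ?nnegrE ?normc_ge0 ?(ltW kap0)//.
  rewrite (le_trans _ hv)// /sqdist (bigD1 i)//= lerDl sumr_ge0// => j _.
  exact: sqr_ge0.
pose q := tfreq M (fun n => if inL n then tpc s n - tpc r n else 0).
exists (r ++ q); split.
  move=> n Ln; rewrite tpc_cat tpc_freq; case: ifPn => [_|nM].
    by rewrite /inL ifT ?asboolT// addrC subrK.
  rewrite -ltnNge in nM; rewrite r0// addr0 tdeg_tpc//.
  exact: leq_ltn_trans DM nM.
rewrite (le_trans (Rintegral_nc_tpD _ _))// mulrDl mul1r lerD//.
apply: Rintegral_haar_le; first by apply: continuous_normc; exact: ccontinuous_tp.
move=> z; rewrite tp_freq (le_trans (normc_sum _ _ _))//.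
have -> : delta = \sum_(i < (M + M).+1) kap.
  by rewrite sumr_const card_ord /kap -[RHS]mulr_natr divfK// pnatr_eq0.
apply: ler_sum => i _; rewrite Normc.normcM normc_chr mulr1.
have := small i; rewrite /co; case: ifP => _; last by rewrite subr0.
by rewrite normc_sub.
Qed.

End correction.

(** * Integration against charges *)

Section bounded_integral.
Context d (T : measurableType d) (R : realType).
Implicit Types (p n m : {finite_measure set T -> \bar R}) (phi g : T -> R).

Definition bounded_by phi (B : R) := forall x, `|phi x| <= B.

Lemma integrable_bounded (m : {measure set T -> \bar R}) phi g B :
  measurable_fun setT phi -> bounded_by phi B ->
  m.-integrable setT (EFin \o g) ->
  m.-integrable setT (EFin \o (fun x => phi x * g x)).
Proof.
move=> mphi pB ig.
have mg : measurable_fun setT g by case/integrableP : ig => /measurable_EFinP.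
have iB := integrableZ_EFin `|B| measurableT (integrable_abse ig).
apply: le_integrable iB => //.
  by apply/measurable_EFinP; exact: measurable_funM.
move=> x _ /=; rewrite lee_fin normrM normrM !normr_id ler_wpM2r//.
exact: le_trans (pB x) (ler_norm _).
Qed.

Lemma integrable_bounded1 (m : {finite_measure set T -> \bar R}) phi B :
  measurable_fun setT phi -> bounded_by phi B ->
  m.-integrable setT (EFin \o phi).
Proof.
move=> mphi pB.
have -> : phi = fun x => phi x * 1 by apply/funext => x; rewrite mulr1.
apply: (@integrable_bounded m phi (fun=> 1) B) => //.
by apply: finite_measure_integrable_cst.
Qed.

(** The range of [phi] is cut into intervals of length 1 / (N + 1), and [phi] is replaced by the
    left end of its interval. *)
Lemma step_approx phi B (N : nat) : measurable_fun setT phi -> bounded_by phi B ->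
  exists (s : seq (R * set T)), (forall x, x \in s -> measurable x.2) /\
    forall x, `|phi x - \sum_(y <- s) y.1 * \1_(y.2) x| <= N.+1%:R^-1.
Proof.
move=> mphi pB.
have [K BK] : exists K : nat, `|B| * N.+1%:R < K%:R.
  by exists (Num.truncn (`|B| * N.+1%:R)).+1; exact: truncnS_gt.
pose lo (k : nat) : R := (k%:R - K%:R) / N.+1%:R.
pose A k := phi @^-1` `[lo k, lo k.+1[.
pose s := [seq (lo k, A k) | k <- iota 0 (K + K)].
exists s; split.
  move=> x /mapP[k _ ->] /=; rewrite -[X in measurable X]setTI.
  by apply: mphi => //; exact: measurable_itv.
move=> x; rewrite big_map.
have Np : 0 < N.+1%:R :> R by [].
have := pB x; rewrite ler_norml => /andP[b1 b2].
have hB : B <= `|B| := ler_norm _.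
pose k0 := Num.truncn (phi x * N.+1%:R + K%:R).
have p0 : 0 <= phi x * N.+1%:R + K%:R.
  have : - `|B| * N.+1%:R <= phi x * N.+1%:R by rewrite ler_wpM2r//; lra.
  by move: BK; rewrite mulNr; lra.
have /andP[k1 k2] := truncn_itv p0; rewrite -/k0 in k1 k2.
have xA : A k0 x.
  rewrite /A /= in_itv/= /lo; apply/andP; split.
    by rewrite ler_pdivrMr//; lra.
  by rewrite ltr_pdivlMr//; lra.
have k0K : (k0 < K + K)%N.
  rewrite -(ltr_nat R) natrD (le_lt_trans k1)// ltrD2r.
  by rewrite (le_lt_trans _ BK)// ler_wpM2r//; lra.
have uniqA k : A k x -> k = k0.
  rewrite /A /= in_itv/= /lo => /andP[]; rewrite ler_pdivrMr// ltr_pdivlMr// => h1 h2.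
  have h3 : k%:R <= phi x * N.+1%:R + K%:R by lra.
  have h4 : phi x * N.+1%:R + K%:R < k.+1%:R by lra.
  have kk0 : (k < k0.+1)%N by rewrite -(ltr_nat R) (le_lt_trans h3).
  have k0k : (k0 < k.+1)%N by rewrite -(ltr_nat R) (le_lt_trans k1).
  by apply/eqP; rewrite eqn_leq -ltnS kk0 -ltnS k0k.
rewrite (bigD1_seq k0) ?iota_uniq ?mem_iota//=. rewrite indicE mem_set// mulr1.
rewrite big1_seq ?addr0; last first.
  move=> k /andP[kk0 _]; rewrite indicE memNset ?mulr0// => /uniqA kE.
  by rewrite kE eqxx in kk0.
move: xA; rewrite /A /= in_itv/= => /andP[h1 h2].
rewrite ger0_norm ?subr_ge0//.
have -> : (N.+1%:R^-1 : R) = lo k0.+1 - lo k0.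
  rewrite /lo -mulrBl (_ : k0.+1%:R - K%:R - (k0%:R - K%:R) = 1) ?mul1r//.
  by rewrite -[k0.+1%:R]natr1; ring.
by rewrite lerD2r ltW.
Qed.

Lemma Rintegral_le_sup (m : {finite_measure set T -> \bar R}) phi B :
  measurable_fun setT phi -> bounded_by phi B ->
  `|\int[m]_x phi x| <= B * fine (m setT).
Proof.
move=> mphi pB.
have iphi := @integrable_bounded1 m phi B mphi pB.
rewrite (le_trans (le_normr_Rintegral _ _))// -(Rintegral_cst m measurableT).
apply: le_Rintegral => //.
- exact: integrable_abse iphi.
- exact: finite_measure_integrable_cst.
Qed.

(** The Jordan parts of a sum are not the sums of the Jordan parts, so both sides are compared
    through their values on sets. This settles step functions; a uniform error 1 / (N + 1) then
    costs at most Q / (N + 1), with Q the total mass involved. *)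
Lemma eq_integral_density (p n p' n' : {finite_measure set T -> \bar R})
    (m : {measure set T -> \bar R}) g :
  m.-integrable setT (EFin \o g) ->
  (forall A, measurable A ->
    fine (p A) - fine (n A) = fine (p' A) - fine (n' A) + \int[m]_(x in A) g x) ->
  forall phi B, measurable_fun setT phi -> bounded_by phi B ->
    \int[p]_x phi x - \int[n]_x phi x =
    \int[p']_x phi x - \int[n']_x phi x + \int[m]_x (phi x * g x).
Proof.
move=> ig pn phi B mphi pB.
have mg : measurable_fun setT g by case/integrableP : ig => /measurable_EFinP.
pose G := \int[m]_x `|g x|.
pose Q := fine (p setT) + fine (n setT) + fine (p' setT) + fine (n' setT) + G.
have G0 : 0 <= G by apply: Rintegral_ge0 => x _.
have Q0 : 0 <= Q by rewrite /Q !addr_ge0// fine_ge0.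
have step (s : seq (R * set T)) : (forall x, x \in s -> measurable x.2) ->
    let h x := \sum_(y <- s) y.1 * \1_(y.2) x in
    [/\ measurable_fun setT h, exists C, bounded_by h C &
    \int[p]_x h x - \int[n]_x h x =
    \int[p']_x h x - \int[n']_x h x + \int[m]_x (h x * g x)].
  elim: s => [_|[a A] s ih mA] /=.
    split.
    - by under eq_fun do rewrite big_nil; exact: measurable_cst.
    - by exists 0 => x; rewrite big_nil normr0.
    - have Z (q : {measure set T -> \bar R}) (k : T -> R) :
          \int[q]_x ((\sum_(y <- [::]) y.1 * \1_(y.2) x) * k x) = 0.
        by under eq_Rintegral do rewrite big_nil mul0r; rewrite Rintegral_cst// mul0r.
      have Z1 (q : {measure set T -> \bar R}) :
          \int[q]_x (\sum_(y <- [::]) y.1 * \1_(y.2) x) = 0.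
        by under eq_Rintegral do rewrite big_nil; rewrite Rintegral_cst// mul0r.
      by rewrite !Z1 Z !subrr addr0.
  have [|mh [C hC] hE] := ih; first by move=> x xs; apply: mA; rewrite inE xs orbT.
  have mA' : measurable A by exact: (mA (a, A) (mem_head _ _)).
  pose h x := \sum_(y <- s) y.1 * \1_(y.2) x.
  pose h1 x := a * \1_A x.
  have E : (fun x => \sum_(y <- (a, A) :: s) y.1 * \1_(y.2) x) = fun x => h1 x + h x.
    by apply/funext => x; rewrite big_cons.
  have mh1 : measurable_fun setT h1.
    by apply: measurable_funM => //; exact: measurable_indic.
  have hC1 : bounded_by h1 `|a|.
    move=> x; rewrite /h1 normrM indicE ler_piMr//.
    by case: (_ \in _); rewrite ?normr1 ?normr0.
  split.
  - by rewrite E; exact: measurable_funD.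
  - exists (`|a| + C) => x; have b1 := hC1 x; have b2 := hC x.
    by rewrite big_cons; apply: le_trans (ler_normD _ _) (lerD b1 b2).
  - have R1 (q : {finite_measure set T -> \bar R}) :
        \int[q]_x h1 x = a * fine (q A).
      rewrite RintegralZl//; last first.
        apply: (@integrable_bounded1 q _ 1); first exact: measurable_indic.
        by move=> x; rewrite indicE; case: (_ \in _); rewrite ?normr1 ?normr0.
      by congr (_ * _); rewrite /Rintegral integral_indic// setIT.
    have R2 : \int[m]_x (h1 x * g x) = a * \int[m]_(x in A) g x.
      rewrite [in RHS]Rintegral_mkcond -RintegralZl//.
        apply: eq_Rintegral => x _; rewrite /h1 -mulrA; congr (_ * _).
        by rewrite patchE indicE; case: (_ \in _); rewrite ?mul1r ?mul0r.
      rewrite (_ : _ \o _ = EFin \o (fun x => \1_A x * g x)).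
        apply: (@integrable_bounded m (\1_A : T -> R) g 1) => //.
        by move=> x; rewrite indicE; case: (_ \in _); rewrite ?normr1 ?normr0.
      apply/funext => x /=; rewrite patchE indicE.
      by case: (_ \in _); rewrite ?mul1r ?mul0r.
    have S (q : {finite_measure set T -> \bar R}) :
       \int[q]_x (\sum_(y <- (a, A) :: s) y.1 * \1_(y.2) x) =
       \int[q]_x h1 x + \int[q]_x h x.
      rewrite -RintegralD//; last 2 first.
      + exact: integrable_bounded1 hC1.
      + exact: integrable_bounded1 hC.
      by apply: eq_Rintegral => x _; rewrite big_cons.
    have S2 : \int[m]_x ((\sum_(y <- (a, A) :: s) y.1 * \1_(y.2) x) * g x) =
       \int[m]_x (h1 x * g x) + \int[m]_x (h x * g x).
      rewrite -RintegralD//; last 2 first.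
      + exact: integrable_bounded hC1 _.
      + exact: integrable_bounded hC _.
      by apply: eq_Rintegral => x _; rewrite big_cons mulrDl.
    rewrite !S S2 !R1 R2; have := pn A mA'; rewrite -/(h) in hE *.
    move: hE; rewrite -/h.
    set h_p := \int[p]_x h x; set h_n := \int[n]_x h x.
    set h_p' := \int[p']_x h x; set h_n' := \int[n']_x h x.
    set h_m := \int[m]_x (h x * g x); set g_A := \int[m]_(x in A) g x.
    move=> e1 e2; rewrite [LHS](_ : _ = a * (fine (p A) - fine (n A)) + (h_p - h_n)); last by ring.
    by rewrite e1 e2; ring.
apply/eqP; rewrite -subr_eq0 -normr_eq0 eq_le normr_ge0 andbT.
apply/ler_addgt0Pl => e e0; rewrite addr0.
pose N := Num.truncn (Q / e).
have QN : Q * N.+1%:R^-1 <= e.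
  by rewrite ler_pdivrMr// mulrC -ler_pdivrMr// ltW// truncnS_gt.
have [s [ms hs]] := step_approx N mphi pB.
have [mh [C hC] hE] := step _ ms.
pose h x := \sum_(y <- s) y.1 * \1_(y.2) x.
pose r x := phi x - h x.
have mr : measurable_fun setT r by exact: measurable_funB.
have rB : bounded_by r N.+1%:R^-1 by exact: hs.
have D (q : {finite_measure set T -> \bar R}) :
    \int[q]_x phi x = \int[q]_x h x + \int[q]_x r x.
  rewrite -RintegralD//; last 2 first.
  - exact: integrable_bounded1 hC.
  - exact: integrable_bounded1 rB.
  by apply: eq_Rintegral => x _; rewrite /r addrC subrK.
have D2 : \int[m]_x (phi x * g x) = \int[m]_x (h x * g x) + \int[m]_x (r x * g x).
  rewrite -RintegralD//; last 2 first.
  - exact: integrable_bounded hC _.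
  - exact: integrable_bounded rB _.
  by apply: eq_Rintegral => x _; rewrite /r; ring.
have b q := @Rintegral_le_sup q r _ mr rB.
have b3 : `|\int[m]_x (r x * g x)| <= N.+1%:R^-1 * G.
  have irg := @integrable_bounded m r g _ mr rB ig.
  rewrite (le_trans (le_normr_Rintegral _ _))// /G -RintegralZl//; last first.
    exact: integrable_abse ig.
  apply: le_Rintegral => //.
  - exact: integrable_abse irg.
  - by apply: integrableZ_EFin => //; exact: integrable_abse ig.
  - by move=> x _; rewrite normrM ler_wpM2r.
have -> : \int[p]_x phi x - \int[n]_x phi x -
      (\int[p']_x phi x - \int[n']_x phi x + \int[m]_x (phi x * g x)) =
    \int[p]_x r x - \int[n]_x r x - \int[p']_x r x + \int[n']_x r x -
    \int[m]_x (r x * g x).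
  move: hE; rewrite !D D2 -/h; move: (\int[p]_x h x) => a hE.
  by rewrite (_ : a = \int[n]_x h x +
      (\int[p']_x h x - \int[n']_x h x + \int[m]_x (h x * g x))); [ring|rewrite -hE; ring].
rewrite (le_trans _ QN)//.
have norm5 (x1 x2 x3 x4 x5 y1 y2 y3 y4 y5 : R) : `|x1| <= y1 -> `|x2| <= y2 ->
    `|x3| <= y3 -> `|x4| <= y4 -> `|x5| <= y5 ->
    `|x1 - x2 - x3 + x4 - x5| <= y1 + y2 + y3 + y4 + y5.
  by rewrite !ler_norml; lra.
apply: le_trans (norm5 _ _ _ _ _ _ _ _ _ _ (b p) (b n) (b p') (b n') b3) _.
by rewrite /Q le_eqVlt; apply/orP; left; apply/eqP; ring.
Qed.

End bounded_integral.

Section charge_integral.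
Context d (T : measurableType d) (R : realType).

Lemma jordan_decomp_fine (s : {charge set T -> \bar R}) P N
    (sPN : hahn_decomposition s P N) A : measurable A ->
  fine (s A) = fine (jordan_pos sPN A) - fine (jordan_neg sPN A).
Proof.
move=> mA; rewrite [in LHS](jordan_decomp sPN mA)//=.
by rewrite /cadd /= cscaleN1 fineD ?fin_numN ?fin_num_measure// fineN.
Qed.

Lemma charge_Rintegral_density (sigma tau : {charge set T -> \bar R})
    (m : {measure set T -> \bar R}) (g phi : T -> R) B :
  m.-integrable setT (EFin \o g) ->
  (forall A, measurable A ->
    fine (tau A) = fine (sigma A) + \int[m]_(x in A) g x) ->
  measurable_fun setT phi -> bounded_by phi B ->
  charge_Rintegral tau phi =
  charge_Rintegral sigma phi + \int[m]_x (phi x * g x).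
Proof.
move=> ig ts mphi pB.
apply: (eq_integral_density ig _ mphi pB) => A mA.
by rewrite -!jordan_decomp_fine// ts.
Qed.

End charge_integral.

(** * Variation and densities *)

Section complex_charge.
Context d (T : measurableType d) (R : realType).
Variables s1 s2 : {charge set T -> \bar R}.

(** Densities are added to the real and imaginary parts separately; this reassembles two real
    charges into a complex one. *)
Definition complex_charge (A : set T) : \bar R[i] :=
  (fine (s1 A) +i* fine (s2 A))%:E.

Let finite : fin_num_fun complex_charge. Proof. by []. Qed.

Let fine_sum (s : {charge set T -> \bar R}) (F : nat -> set T) n :
  (forall k, measurable (F k)) ->
  \sum_(i < n) fine (s (F i)) = fine (\sum_(i < n) s (F i))%E.
Proof.
move=> mF; elim: n => [|n ih]; first by rewrite !big_ord0.
rewrite !big_ord_recr/= ih fineD ?fin_num_measure//.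
by rewrite sum_fin_num; apply/allP => x /mapP[i _ ->]; exact: fin_num_measure.
Qed.

Let sumE (F : nat -> set T) n : (forall k, measurable (F k)) ->
  (\sum_(i < n) complex_charge (F i))%E =
  (fine (\sum_(i < n) s1 (F i))%E +i* fine (\sum_(i < n) s2 (F i))%E)%:E.
Proof.
move=> mF; rewrite sumEFin -!fine_sum//; congr EFin.
by apply: complex_ext; rewrite /= ?Re_sum ?Im_sum.
Qed.

Let semi_additive : measure_function.semi_additive complex_charge.
Proof.
move=> F n mF tF mUF; rewrite sumE//.
by rewrite /complex_charge !charge_semi_additive.
Qed.

Let cvg_fine_sum (s : {charge set T -> \bar R}) (F : nat -> set T) :
  (forall k, measurable (F k)) -> trivIset setT F -> measurable (\bigcup_n F n) ->
  fine (\sum_(0 <= i < n) s (F i))%E @[n --> \oo] --> fine (s (\bigcup_n F n)).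
Proof.
move=> mF tF mUF; apply: fine_cvg; rewrite fineK ?fin_num_measure//.
exact: charge_semi_sigma_additive.
Qed.

Let sigma_additive : semi_sigma_additive complex_charge.
Proof.
move=> F mF tF mUF.
rewrite (_ : (fun n => _) = fun n =>
    (fine (\sum_(0 <= i < n) s1 (F i))%E +i*
     fine (\sum_(0 <= i < n) s2 (F i))%E)%:E); last first.
  by apply/funext => n; rewrite !big_mkord sumE.
have c1 := @cvg_fine_sum s1 F mF tF mUF; have c2 := @cvg_fine_sum s2 F mF tF mUF.
have cC : continuous (fun x : R * R => x.1 +i* x.2 : R[i]).
  by apply: continuous_Complex => x; [exact: cvg_fst|exact: cvg_snd].
move=> P hP.
have [[U V] /= [Ua Vb] UV] :=
  cC (fine (s1 (\bigcup_n F n)), fine (s2 (\bigcup_n F n))) (P \o EFin) hP.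
have hU : \forall n \near \oo, U (fine (\sum_(0 <= i < n) s1 (F i))%E) := c1 _ Ua.
have hV : \forall n \near \oo, V (fine (\sum_(0 <= i < n) s2 (F i))%E) := c2 _ Vb.
suff : \forall n \near \oo, P (fine (\sum_(0 <= i < n) s1 (F i))%E +i*
     fine (\sum_(0 <= i < n) s2 (F i))%E)%:E by [].
near=> n; apply: (UV (_, _)); split; first by near: n.
by near: n.
Unshelve. all: by end_near.
Qed.

HB.instance Definition _ := isFinite.Build _ _ _ complex_charge finite.
HB.instance Definition _ := isAdditiveCharge.Build _ _ _ complex_charge semi_additive.
HB.instance Definition _ := isSemiSigmaAdditive.Build _ _ _ complex_charge sigma_additive.

End complex_charge.

Section add_density.
Context d (T : measurableType d) (R : realType).
Variables (mu : {charge set T -> \bar R[i]}) (m : {measure set T -> \bar R}).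
Variables (g : T -> R[i]) (ig : cintegrable m setT g).

Lemma exists_add_density : exists nu : {charge set T -> \bar R[i]},
  forall A, measurable A -> fine (nu A) = fine (mu A) + cint m A g.
Proof.
have [gr gi] := ig.
exists (complex_charge (cadd (charge_Re mu) (induced_charge gr))
  (cadd (charge_Im mu) (induced_charge gi))).
move=> A mA; rewrite /complex_charge /= /cadd.
have fr : (induced_charge gr A) \is a fin_num by exact: fin_num_measure.
have fi : (induced_charge gi A) \is a fin_num by exact: fin_num_measure.
by apply: complex_ext; rewrite /= ?ReD ?ImD fineD.
Qed.

Lemma charge_Cintegral_density (nu : {charge set T -> \bar R[i]}) (f : T -> R[i]) :
  (forall A, measurable A -> fine (nu A) = fine (mu A) + cint m A g) ->
  measurable_fun setT (fun x => Re (f x)) -> measurable_fun setT (fun x => Im (f x)) ->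
  (forall x, nc (f x) <= 1) ->
  charge_Cintegral nu f = charge_Cintegral mu f + cint m setT (fun x => g x * f x).
Proof.
move=> nuE mr mi f1; have [gr gi] := ig.
have br : bounded_by (fun x => Re (f x)) 1 by move=> x; exact: le_trans (normc_Re _) _.
have bi : bounded_by (fun x => Im (f x)) 1 by move=> x; exact: le_trans (normc_Im _) _.
have Er A : measurable A -> fine (charge_Re nu A) =
    fine (charge_Re mu A) + \int[m]_(x in A) Re (g x).
  by move=> mA; rewrite /charge_Re /= nuE// ReD.
have Ei A : measurable A -> fine (charge_Im nu A) =
    fine (charge_Im mu A) + \int[m]_(x in A) Im (g x).
  by move=> mA; rewrite /charge_Im /= nuE// ImD.
rewrite /charge_Cintegral.
rewrite !(charge_Rintegral_density gr Er mr br) !(charge_Rintegral_density gr Er mi bi).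
rewrite !(charge_Rintegral_density gi Ei mr br) !(charge_Rintegral_density gi Ei mi bi).
rewrite /cint.
have -> : \int[m]_x Re (g x * f x) =
    \int[m]_x (Re (f x) * Re (g x)) - \int[m]_x (Im (f x) * Im (g x)).
  rewrite -RintegralB//; last 2 first.
  - exact: integrable_bounded br gr.
  - exact: integrable_bounded bi gi.
  by apply: eq_Rintegral => x _; rewrite ReM; ring.
have -> : \int[m]_x Im (g x * f x) =
    \int[m]_x (Im (f x) * Re (g x)) + \int[m]_x (Re (f x) * Im (g x)).
  rewrite -RintegralD//; last 2 first.
  - exact: integrable_bounded bi gr.
  - exact: integrable_bounded br gi.
  by apply: eq_Rintegral => x _; rewrite ImM; ring.
by apply: complex_ext => /=; ring.
Qed.

End add_density.

Section variation.
Context d (T : measurableType d) (R : realType).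
Implicit Types (mu nu : {charge set T -> \bar R[i]}) (F G : (set T)^nat) (A B : set T).

Definition mpartition A F :=
  [/\ forall i, measurable (F i), trivIset setT F & \bigcup_i F i = A].

Definition variation_sum mu F : \bar R :=
  (\sum_(0 <= i <oo) (nc (fine (mu (F i))))%:E)%E.

Lemma variation_sum_le mu A F : mpartition A F ->
  (variation_sum mu F <= variation_measure mu A)%E.
Proof. by move=> pF; apply: ereal_sup_ubound; exists F. Qed.

Lemma variation_le mu A (b : \bar R) :
  (forall F, mpartition A F -> (variation_sum mu F <= b)%E) ->
  (variation_measure mu A <= b)%E.
Proof. by move=> H; apply: ge_ereal_sup => _ [F pF <-]; exact: H. Qed.

(** Superadditivity of the variation over disjoint sets, for given partitions: interleaved, [F] at
    even and [G] at odd indices, they form a partition of the union. *)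
Lemma variation_sum_join mu A B F G : mpartition A F -> mpartition B G ->
  A `&` B = set0 ->
  (variation_sum mu F + variation_sum mu G <= variation_measure mu (A `|` B))%E.
Proof.
move=> [mF tF FA] [mG tG GB] AB.
pose H i := if odd i then G i./2 else F i./2.
have He i : H i.*2 = F i by rewrite /H odd_double doubleK.
have Ho i : H i.*2.+1 = G i by rewrite /H /= odd_double /= uphalf_double.
have FG i j : F i `&` G j = set0.
  by apply/seteqP; split => // x [Fx Gx]; rewrite -AB; split;
    [rewrite -FA; exists i|rewrite -GB; exists j].
have pH : mpartition (A `|` B) H.
  split.
  - by move=> i; rewrite /H; case: ifP.
  - apply/trivIsetP => i j _ _ ij; rewrite /H.
    have ijh : odd i = odd j -> i./2 != j./2.
      move=> o; apply: contra ij => /eqP h.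
      by rewrite -(odd_double_half i) -(odd_double_half j) o h.
    case: ifPn => oi; case: ifPn => oj.
    + by move/trivIsetP : tG; apply => //; apply: ijh; rewrite oi oj.
    + by rewrite setIC FG.
    + by rewrite FG.
    + by move/trivIsetP : tF; apply => //; apply: ijh; rewrite (negbTE oi) (negbTE oj).
  - apply/seteqP; split => [x [i _]|x [Ax|Bx]].
    + rewrite /H; case: ifP => _ Hx; [right; rewrite -GB|left; rewrite -FA].
      * by exists i./2.
      * by exists i./2.
    + by move: Ax; rewrite -FA => -[i _ Fx]; exists i.*2 => //; rewrite He.
    + by move: Bx; rewrite -GB => -[i _ Gx]; exists i.*2.+1 => //; rewrite Ho.
apply: le_trans (variation_sum_le mu pH).
have c0 (F' : (set T)^nat) i : (0 <= (nc (fine (mu (F' i))))%:E)%E.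
  by rewrite lee_fin normc_ge0.
rewrite /variation_sum -nneseriesD//.
apply: lime_le; first by apply: is_cvg_nneseries => n _ _; exact: adde_ge0.
near=> n.
apply: (@le_trans _ _ (\sum_(0 <= i < n.*2) (nc (fine (mu (H i))))%:E)%E); last first.
  exact: nneseries_lim_ge.
rewrite le_eqVlt; apply/orP; left; apply/eqP.
elim: (n) => [|k ih]; first by rewrite !big_geq.
rewrite big_nat_recr//= ih doubleS !big_nat_recr//= He Ho -addeA.
by [].
Unshelve. all: by end_near. Qed.

End variation.

(** * Splitting off an absolutely continuous part *)

Section almost_decomposition.
Context d (T : measurableType d) (R : realType).
Variable m : {finite_measure set T -> \bar R}.

Lemma density_of_dominated (sigma : {charge set T -> \bar R}) (D : set T) :
  measurable D ->
  (forall A, measurable A -> A `<=` D -> m A = 0 -> sigma A = 0)%E ->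
  exists f : T -> R, m.-integrable setT (EFin \o f) /\
    forall A, measurable A -> fine (sigma (A `&` D)) = \int[m]_(x in A) f x.
Proof.
move=> mD dom.
have dom' : crestr0 sigma mD `<< m.
  apply/null_content_dominatesP => A mA mA0.
  rewrite /crestr0 mem_set//= /crestr; apply: dom => //; first exact: measurableI.
  by apply/eqP; rewrite eq_le measure_ge0 andbT -mA0 le_measure ?inE//; exact: measurableI.
pose f := Radon_Nikodym (crestr0 sigma mD) m.
have ff x : f x = (fine (f x))%:E by rewrite fineK//; exact: Radon_Nikodym_fin_num.
exists (fine \o f); split.
  rewrite (_ : _ \o _ = f); first exact: Radon_Nikodym_integrable.
  by apply/funext => x /=; rewrite -ff.
move=> A mA; have -> : sigma (A `&` D) = crestr0 sigma mD A.
  by rewrite /crestr0 mem_set.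
rewrite (Radon_Nikodym_integral dom' mA) /Rintegral; congr fine.
by apply: eq_integral => x _ /=; rewrite -ff.
Qed.

(* A set S off which |mu| <= t m is the negative set of a Hahn decomposition of
   (|Re mu| + |Im mu|) - t m, and m S = O(1 / t). *)
Lemma almost_decomposition (mu : {charge set T -> \bar R[i]}) (e : R) : 0 < e ->
  exists S (f : T -> R[i]), [/\ measurable S, (m S <= e%:E)%E, cintegrable m setT f &
    forall A, measurable A -> fine (mu (A `&` ~` S)) = cint m A f].
Proof.
move=> e0.
have [PR [NR hR]] := Hahn_decomposition (charge_Re mu).
have [PI [NI hI]] := Hahn_decomposition (charge_Im mu).
pose vR : {charge set T -> \bar R} := charge_variation hR.
pose vI : {charge set T -> \bar R} := charge_variation hI.
pose tau : {charge set T -> \bar R} := cadd vR vI.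
pose V := fine (tau setT).
pose mc : {charge set T -> \bar R} := charge_of_finite_measure m.
have vR0 A : (0 <= vR A)%E := @measure_ge0 _ _ _ (charge_variation hR) A.
have vI0 A : (0 <= vI A)%E := @measure_ge0 _ _ _ (charge_variation hI) A.
have tauT A : measurable A -> (tau A <= tau setT)%E.
  move=> mA; apply: leeD.
  - by apply: (@le_measure _ _ _ (charge_variation hR)); rewrite ?inE.
  - by apply: (@le_measure _ _ _ (charge_variation hI)); rewrite ?inE.
have V0 : 0 <= V by apply: fine_ge0; exact: adde_ge0.
(* On the positive set S of [kappa] one has t * m S <= tau S <= V <= t * e; the summand 1 keeps t
   positive when V = 0. *)
pose t := V / e + 1.
have t0 : 0 < t by rewrite ltr_wpDl// divr_ge0// ltW.
pose kappa : {charge set T -> \bar R} := cadd tau (cscale (- t) mc).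
have kE A : measurable A -> fine (kappa A) = fine (tau A) - t * fine (m A).
  move=> mA; rewrite /kappa /cadd /= /cscale fineD; last 2 first.
  - exact: (fin_num_measure tau).
  - by rewrite fin_numM// fin_num_measure.
  by rewrite fineM ?fin_num_measure//= mulNr.
have [S [N [[mS posS] [mN negN] SN SN0]]] := Hahn_decomposition kappa.
have NS : N = ~` S.
  apply/seteqP; split => x.
    by move=> Nx Sx; suff : (S `&` N) x by rewrite SN0.
  by move=> nSx; have [] : (S `|` N) x by rewrite SN.
(* Off S the charge [kappa] is nonpositive, so tau <= t * m there; thus [tau], and with it both
   parts of [mu], vanishes on the null sets of [m]. *)
have dom A : measurable A -> A `<=` ~` S -> m A = 0%E -> tau A = 0%E.
  move=> mA AS mA0; have := negN A mA; rewrite NS => /(_ AS) => h.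
  have : fine (kappa A) <= 0 by rewrite -lee_fin fineK// (fin_num_measure kappa).
  rewrite kE// mA0 /= mulr0 subr0 => h2.
  apply/eqP; rewrite eq_le; apply/andP; split; last exact: adde_ge0.
  by rewrite -[leLHS]fineK ?lee_fin//; exact: (fin_num_measure tau).
have domR A : measurable A -> A `<=` ~` S -> m A = 0%E -> charge_Re mu A = 0%E.
  move=> mA AS mA0; apply/eqP; rewrite -abse_eq0 eq_le abse_ge0 andbT.
  rewrite (le_trans (abse_charge_variation hR mA))// -(dom _ mA AS mA0).
  by rewrite -[leLHS]adde0 leeD.
have domI A : measurable A -> A `<=` ~` S -> m A = 0%E -> charge_Im mu A = 0%E.
  move=> mA AS mA0; apply/eqP; rewrite -abse_eq0 eq_le abse_ge0 andbT.
  rewrite (le_trans (abse_charge_variation hI mA))// -(dom _ mA AS mA0).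
  by rewrite -[leLHS]add0e leeD.
have [fr [ir hfr]] := density_of_dominated (measurableC mS) domR.
have [fi [ii hfi]] := density_of_dominated (measurableC mS) domI.
exists S, (fun x => fr x +i* fi x); split => //.
- have : 0 <= fine (kappa S) by apply: fine_ge0; exact: posS.
  rewrite kE// subr_ge0 => h.
  have h2 : fine (tau S) <= V.
    by apply: fine_le; rewrite ?(fin_num_measure tau)//; exact: tauT.
  rewrite -[m S]fineK ?fin_num_measure// lee_fin -(ler_pM2l t0) (le_trans h)//.
  rewrite (le_trans h2)// /t mulrDl mul1r divfK ?gt_eqF// lerDl ltW//.
- by move=> A mA; apply: complex_ext => /=; [exact: hfr|exact: hfi].
Qed.

(* The space is partitioned according to the small square containing the value
   of f. *)
Lemma variation_density_lower (f : T -> R[i]) (e : R) : cintegrable m setT f -> 0 < e ->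
  exists2 F : (set T)^nat, mpartition setT F &
    ((\int[m]_x nc (f x))%:E <=
     \sum_(0 <= i <oo) (nc (cint m (F i) f))%:E + e%:E)%E.
Proof.
move=> fi e0; have [fr fim] := fi.
have inc := integrable_normc measurableT fi.
pose mT := fine (m setT).
have mT0 : 0 <= mT by exact: fine_ge0.
pose w := e / (4 * (mT + 1)).
have w0 : 0 < w by rewrite divr_gt0// mulr_gt0// ltr_wpDl.
pose sq (a b : int) : set T :=
  [set x | (a%:~R * w <= Re (f x) < (a + 1)%:~R * w) /\
           (b%:~R * w <= Im (f x) < (b + 1)%:~R * w)].
(* The squares are enumerated through [unpickle]. The test on [pickle] lets each square occur at one
   index only, which makes the pieces disjoint. *)
pose F (k : nat) : set T := if (unpickle k : option (int * int)) is Some ab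
  then (if pickle ab == k then sq ab.1 ab.2 else set0) else set0.
have msq a b : measurable (sq a b).
  have -> : sq a b = ((fun x => Re (f x)) @^-1` `[a%:~R * w, (a + 1)%:~R * w[) `&`
      ((fun x => Im (f x)) @^-1` `[b%:~R * w, (b + 1)%:~R * w[).
    by apply/seteqP; split => x; rewrite /sq /= !in_itv/=.
  apply: measurableI.
  - rewrite -[X in measurable X]setTI.
    by case/integrableP : fr => /measurable_EFinP mr _; apply: mr => //; exact: measurable_itv.
  - rewrite -[X in measurable X]setTI.
    by case/integrableP : fim => /measurable_EFinP mi _; apply: mi => //; exact: measurable_itv.
have mF k : measurable (F k).
  by rewrite /F; case: unpickle => // ab; case: ifP.
have itv_uniq (a b : int) (x : R) : a%:~R * w <= x < (a + 1)%:~R * w ->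
    b%:~R * w <= x < (b + 1)%:~R * w -> a = b.
  move=> /andP[a1 a2] /andP[b1 b2].
  have h1 : a%:~R < (b + 1)%:~R :> R by rewrite -(ltr_pM2r w0) (le_lt_trans a1).
  have h2 : b%:~R < (a + 1)%:~R :> R by rewrite -(ltr_pM2r w0) (le_lt_trans b1).
  by move: h1 h2; rewrite !ltr_int; lia.
have pF : mpartition setT F.
  split => //.
  - apply/trivIsetP => i j _ _ ij; apply/seteqP; split => // x [].
    rewrite /F; case: (unpickle i) => // ab; case: eqP => // abi.
    case: (unpickle j) => // cd; case: eqP => // cdj [h1 h2] [h3 h4].
    move: ij; rewrite -abi -cdj.
    case: ab {abi} h1 h2 => a b /= h1 h2; case: cd {cdj} h3 h4 => u v /= h3 h4.
    by rewrite (itv_uniq _ _ _ h1 h3) (itv_uniq _ _ _ h2 h4) eqxx.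
  - apply/seteqP; split => // x _.
    pose a := Num.floor (Re (f x) / w); pose b := Num.floor (Im (f x) / w).
    exists (pickle (a, b)); first exact: I.
    rewrite /F pickleK eqxx /sq.
    have fl (y : R) : (Num.floor (y / w))%:~R * w <= y < (Num.floor (y / w) + 1)%:~R * w.
      rewrite -ler_pdivlMr// -ltr_pdivrMr//.
      by rewrite floor_le_tmp floorD1_gt.
    by split; exact: fl.
exists F => //.
(* On one square |f - c| <= 2 w for its corner c. This error is paid twice, in replacing |f| by |c|
   and c by the mean of f, whence 4 w. *)
have key i : \int[m]_(x in F i) nc (f x) <=
    nc (cint m (F i) f) + 4 * w * fine (m (F i)).
  have iFi : cintegrable m (F i) f by exact: cintegrableS (subsetT _) fi.
  have [c hc] : exists c : R[i], forall x, F i x -> nc (f x - c) <= 2 * w.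
    rewrite /F; case: unpickle => [ab|]; last by exists 0.
    case: ifP => _; last by exists 0.
    exists ((ab.1%:~R * w) +i* (ab.2%:~R * w)) => x [/andP[a1 a2] /andP[b1 b2]].
    rewrite (le_trans (normc_le_abs _))// ReB ImB /=.
    rewrite !ger0_norm ?subr_ge0//; move: a2 b2; rewrite !intrD.
    by lra.
  have ic : cintegrable m (F i) (fun=> c).
    by split; exact: finite_measure_integrable_cst.
  have id : cintegrable m (F i) (fun x => f x - c) by exact: cintegrableB.
  have idn := integrable_normc (mF i) id.
  have i2w : m.-integrable (F i) (EFin \o (fun=> 2 * w)).
    exact: finite_measure_integrable_cst.
  have b1 : \int[m]_(x in F i) nc (f x - c) <= 2 * w * fine (m (F i)).
    rewrite -Rintegral_cst//; apply: le_Rintegral => //.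
  have b2 : \int[m]_(x in F i) nc (f x) <= nc c * fine (m (F i)) + \int[m]_(x in F i) nc (f x - c).
    rewrite -Rintegral_cst// -RintegralD//; last exact: finite_measure_integrable_cst.
    apply: le_Rintegral => //.
    - exact: integrable_normc.
    - by apply: integrableD_EFin => //; exact: finite_measure_integrable_cst.
    - by move=> x _; rewrite -[in leLHS](subrK c (f x)) addrC le_normcD.
  have b3 : nc c * fine (m (F i)) <= nc (cint m (F i) f) + \int[m]_(x in F i) nc (f x - c).
    have -> : nc c * fine (m (F i)) = nc (cint m (F i) (fun=> c)).
      have -> : cint m (F i) (fun=> c) = (fine (m (F i)))%:C * c.
        rewrite /cint !Rintegral_cst//.
        by apply: complex_ext; rewrite /= ?ReMr ?ImMr mulrC.
      by rewrite Normc.normcM normc_real ger0_norm ?fine_ge0// mulrC.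
    have -> : cint m (F i) (fun=> c) = cint m (F i) f - cint m (F i) (fun x => f x - c).
      by rewrite cintB// opprB addrC subrK.
    rewrite (le_trans (le_normcD _ _))// lerD2l normcN; exact: normc_cint.
  by lra.
have E1 : (\int[m]_x nc (f x))%:E = (\sum_(0 <= i <oo) (\int[m]_(x in F i) nc (f x))%:E)%E.
  have fin i : (\int[m]_(x in F i) (nc (f x))%:E \is a fin_num)%E.
    by apply: integrable_fin_num => //; exact: integrableS (subsetT _) inc.
  rewrite /Rintegral fineK ?integrable_fin_num//.
  have [_ tF UF] := pF.
  rewrite -{1}UF ge0_integral_bigcup//; last 2 first.
  - by rewrite UF; exact: measurable_int inc.
  - by move=> x _; rewrite lee_fin normc_ge0.
  by apply: eq_eseriesr => i _; rewrite fineK.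
have E2 : (mT%:E = \sum_(0 <= i <oo) (fine (m (F i)))%:E)%E.
  have [_ tF UF] := pF.
  rewrite /mT fineK ?fin_num_measure// -UF measure_bigcup//.
  congr (limn _); apply/funext => n; apply: eq_big => [i|i _]; first by rewrite in_setT.
  by rewrite fineK// fin_num_measure.
have n0 i : (0 <= (nc (cint m (F i) f))%:E)%E by rewrite lee_fin normc_ge0.
have E3 : (\sum_(0 <= i <oo) (4 * w * fine (m (F i)))%:E = (4 * w * mT)%:E)%E.
  under eq_eseriesr do rewrite EFinM.
  rewrite nneseriesZl//; first by rewrite [RHS]EFinM E2.
  by move=> i _; rewrite lee_fin fine_ge0.
rewrite E1; apply: (@le_trans _ _ (\sum_(0 <= i <oo)
    ((nc (cint m (F i) f))%:E + (4 * w * fine (m (F i)))%:E))%E).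
  apply: lee_nneseries => [i _|i _].
    by move=> _; rewrite lee_fin; apply: Rintegral_ge0 => x _; exact: normc_ge0.
  by rewrite -EFinD lee_fin.
rewrite nneseriesD//; last first.
  move=> i *; rewrite lee_fin; apply: mulr_ge0; last exact: fine_ge0.
  by apply: mulr_ge0 => //; exact: ltW.
rewrite E3 leeD2l// lee_fin /w.
have -> : 4 * (e / (4 * (mT + 1))) * mT = e * (mT / (mT + 1)).
  by field; rewrite gt_eqF// ltr_wpDl.
by rewrite ler_piMr ?(ltW e0)// ler_pdivrMr ?ltr_wpDl// mul1r lerDl.
Qed.

End almost_decomposition.

(** * The theorem *)

Section variation_bounds.
Context d (T : measurableType d) (R : realType).
Variable m : {finite_measure set T -> \bar R}.
Variables (mu : {charge set T -> \bar R[i]}) (S : set T) (f : T -> R[i]).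
Hypotheses (mS : measurable S) (fi : cintegrable m setT f).
Hypothesis muf : forall A, measurable A -> fine (mu (A `&` ~` S)) = cint m A f.

Lemma charge_splitE A : measurable A ->
  fine (mu A) = fine (mu (A `&` S)) + cint m A f.
Proof.
move=> mA; rewrite -muf// [mu A](chargeDI mu mA mS) setDE addeC fineD//.
- by apply: fin_num_measure; exact: measurableI.
- by apply: fin_num_measure; apply: measurableI => //; exact: measurableC.
Qed.

Lemma mpartition_restr A D (F : (set T)^nat) : measurable D -> mpartition A F ->
  mpartition (A `&` D) (fun i => F i `&` D).
Proof.
move=> mD [mF tF UF]; split.
- by move=> i; exact: measurableI.
- apply/trivIsetP => i j _ _ ij; rewrite setIACA.
  by move/trivIsetP : tF => -> //; rewrite set0I.
- by rewrite -UF setI_bigcupl.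
Qed.

Lemma sum_Rintegral_partition A (F : (set T)^nat) (h : T -> R) :
  mpartition A F -> m.-integrable setT (EFin \o h) -> (forall x, 0 <= h x) ->
  (\sum_(0 <= i <oo) (\int[m]_(x in F i) h x)%:E = (\int[m]_(x in A) h x)%:E)%E.
Proof.
move=> [mF tF UF] ih h0.
have mA : measurable A by rewrite -UF; exact: bigcupT_measurable.
rewrite /Rintegral fineK; last first.
  by apply: integrable_fin_num => //; exact: integrableS (subsetT _) ih.
rewrite -[in RHS]UF ge0_integral_bigcup//.
- apply: eq_eseriesr => i _; rewrite fineK//.
  by apply: integrable_fin_num => //; exact: integrableS (subsetT _) ih.
- rewrite UF; apply: measurable_funS (measurable_int _ ih) => //.
- by move=> x _; rewrite lee_fin.
Qed.

(** On each piece [nu] is [mu] restricted to S plus the integral of f + g. Keeping f + g together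
    preserves the cancellation between the density of [mu] and the perturbation. *)
Lemma variation_add_density_le (nu : {charge set T -> \bar R[i]}) (g : T -> R[i]) A :
  cintegrable m setT g ->
  (forall A, measurable A -> fine (nu A) = fine (mu A) + cint m A g) ->
  (variation_measure nu A <= variation_measure mu (A `&` S) +
    (\int[m]_(x in A) nc (f x + g x))%:E)%E.
Proof.
move=> gi nuE; apply: variation_le => F pF.
have pFS := mpartition_restr mS pF.
have ifg : cintegrable m setT (fun x => f x + g x) by exact: cintegrableD.
have infg := integrable_normc measurableT ifg.
have [mF _ _] := pF.
apply: le_trans (leeD (variation_sum_le mu pFS) (lexx _)).
rewrite -(sum_Rintegral_partition pF infg); last by move=> x; exact: normc_ge0.
rewrite /variation_sum -nneseriesD; last 2 first.
- by move=> i *; rewrite lee_fin normc_ge0.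
- by move=> i *; rewrite lee_fin; apply: Rintegral_ge0 => x _; exact: normc_ge0.
apply: lee_nneseries => [i *|i _]; first by rewrite lee_fin normc_ge0.
rewrite -EFinD lee_fin nuE// charge_splitE// -addrA -cintD//; last 2 first.
- exact: cintegrableS (subsetT _) fi.
- exact: cintegrableS (subsetT _) gi.
rewrite (le_trans (le_normcD _ _))// lerD2l normc_cint//.
exact: cintegrableS (subsetT _) ifg.
Qed.

Lemma variation_set0 : (variation_measure mu set0 <= 0)%E.
Proof.
apply: variation_le => F [_ _ UF]; rewrite /variation_sum eseries0// => i _ _.
have -> : F i = set0 by apply/seteqP; split => // x Fx; rewrite -UF; exists i.
by rewrite charge0 Normc.normc0.
Qed.

(** Any partition of S is joined with a partition of its complement on which the variation sum of
    [mu] nearly attains the integral of |f|. *)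
Lemma variation_density_le (e : R) : 0 < e ->
  (variation_measure mu S + (\int[m]_x nc (f x))%:E <=
   variation_measure mu setT + e%:E)%E.
Proof.
move=> e0; have [G pG hG] := variation_density_lower fi e0.
have pG' := mpartition_restr (measurableC mS) pG; rewrite setTI in pG'.
have [mG _ _] := pG.
have sE : (\sum_(0 <= i <oo) (nc (cint m (G i) f))%:E =
    variation_sum mu (fun i => G i `&` ~` S))%E.
  by apply: eq_eseriesr => i _; rewrite muf.
rewrite -leeBrDr//; apply: variation_le => F pF.
rewrite leeBrDr//; apply: le_trans (leeD (lexx _) hG) _.
rewrite sE addeA leeD2r//.
by have := variation_sum_join mu pF pG' (setICr _); rewrite setUv.
Qed.

End variation_bounds.

Section main.
Context {R : realType}.
Local Notation haar := (@haar R).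

Lemma le_Rintegral_sub (A : set (circle R)) (h k : circle R -> R) : measurable A ->
  haar.-integrable setT (EFin \o h) -> haar.-integrable setT (EFin \o k) ->
  (forall z, 0 <= k z) -> (forall z, A z -> h z <= k z) ->
  \int[haar]_(z in A) h z <= \int[haar]_z k z.
Proof.
move=> mA ih ik k0 hk; rewrite Rintegral_mkcond; apply: le_Rintegral => //.
  rewrite -restrict_EFin; apply: (integrable_mkcond (EFin \o h) mA).1.
  exact: integrableS (subsetT _) ih.
by move=> z _; rewrite patchE; case: ifPn => // /set_mem; exact: hk.
Qed.

(** Markov's inequality for sqrt K. *)
Lemma haar_gt1_le (K : circle R -> R) : continuous K -> (forall z, 0 <= K z) ->
  measurable [set z | 1 < K z] /\
  (haar [set z | (1 < K z)%R] <= (\int[haar]_z Num.sqrt (K z))%:E)%E.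
Proof.
move=> cK K0.
have mK : measurable [set z | 1 < K z].
  rewrite (_ : [set z | _] = K @^-1` `]1, +oo[); last first.
    by apply/seteqP; split => z /=; rewrite in_itv/= andbT.
  rewrite -[X in measurable X]setTI.
  by apply: (measurable_continuous_circle cK) => //; exact: measurable_itv.
split => //.
have isK : haar.-integrable setT (EFin \o (fun z => Num.sqrt (K z))).
  apply: integrable_continuous_circle => z.
  exact: (continuous_comp (cK z) (@sqrt_continuous _ _)).
have i1 : haar.-integrable setT (EFin \o (fun=> 1 : R)).
  by apply: integrable_continuous_circle; exact: cst_continuous.
have h : fine (haar [set z | 1 < K z]) = \int[haar]_(z in [set z | 1 < K z]) (fun=> 1) z.
  by rewrite Rintegral_cst// mul1r.
rewrite -[leLHS]fineK ?fin_num_measure// lee_fin h.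
apply: le_Rintegral_sub => // z /= K1.
by rewrite -[leLHS]sqrtr1 ler_wsqrtr// ltW.
Qed.

End main.

Theorem corollary2p7 (R : realType) (L : set int)
    (mu : {charge set (circle R) -> \bar R[i]}) (e : R) :
  sidon R L -> 0 < e ->
  exists nu : {charge set (circle R) -> \bar R[i]},
    [/\ almost_singular e nu,
        (variation_measure nu setT <= variation_measure mu setT + e%:E)%E &
        forall n, L n -> fourier_stieltjes nu n = fourier_stieltjes mu n].
Proof.
move=> sL e0.
have small_set (a b : R) : 0 < a -> b <= a -> a + b <= a * 8 by lra.
have small_var (a x y z : R) : 0 < a -> x <= a -> y <= a -> z <= a ->
  x + (y + z) <= a * 8 by lra.
have norm_density (a a' x y z u v p : R) : a' <= a -> x <= y + (z + u) ->
  z <= v + a' -> v <= p + y -> y <= a -> u <= a -> x <= p + 4 * a by lra.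
have norm_total (a : R) : 0 < a -> a + 4 * a <= a * 8 by lra.
have e8 : e = e / 8 * 8 by rewrite divfK.
(* The estimates below spend at most five times [eta]. *)
pose eta := e / 8.
have eta0 : 0 < eta by rewrite divr_gt0.
have [C [C0 HC]] := sidon_correction sL.
have [S [f [mS hS fi muf]]] := almost_decomposition (@haar R) mu eta0.
have [s hs] := trig_density fi eta0.
(* W bounds both the sup norm of p and, up to the factor [delta], the coefficients of (K - 1) p.
   Below, W + 1 is used as a positive denominator. *)
pose W := \sum_(x <- s) nc x.2.
have W0 : 0 <= W by apply: sumr_ge0 => x _; exact: normc_ge0.
pose delta := Num.min 1 (eta / (C * (W + 1))).
have CW0 : 0 < C * (W + 1) by rewrite mulr_gt0// ltr_wpDl.
have d0 : 0 < delta by rewrite lt_min ltr01 divr_gt0.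
have d1 : delta <= 1 by rewrite ge_min lexx.
have dCW : C * (delta * (W + 1)) <= eta.
  by rewrite mulrCA -ler_pdivlMr// ge_min lexx orbT.
pose phi z := nc (tp s z).
have cphi : continuous phi by apply: continuous_normc; exact: ccontinuous_tp.
have phi0 z : 0 <= phi z by exact: normc_ge0.
have phiW z : phi z <= W.
  rewrite /phi (le_trans (normc_sum _ _ _))// ler_sum// => x _.
  by rewrite Normc.normcM normc_chr mulr1.
(* The integral of W * sqrt K has to be at most [eta]. *)
pose eta' := eta / (W + 1).
have eta'0 : 0 < eta' by rewrite divr_gt0// ltr_wpDl.
have eta'W : W * eta' <= eta.
  by rewrite mulrCA ler_piMr ?(ltW eta0)// ler_pdivrMr ?ltr_wpDl// mul1r lerDl.
have eta'1 : eta' <= eta.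
  by rewrite ler_pdivrMr ?ltr_wpDl// ler_peMr ?(ltW eta0)// lerDr.
have [k [K [kK phiK sK]]] := riesz_product d0 d1 cphi eta'0.
have cK := continuous_riesz kK; have [kE K0 k0 kd] := kK.
(* The appended pair subtracts 1 from K and so cancels its mean; only coefficients of size at most
   [delta] remain. *)
pose t := tmul s (k ++ [:: (0, -1)]).
have tE z : tp t z = tp s z * ((K z)%:C - 1).
  by rewrite tp_mul tp_cat kE /tp big_seq1 /= chr0 mulr1.
have tcoef n : nc (tpc t n) <= delta * (W + 1).
  rewrite tpc_mul (le_trans (normc_sum _ _ _))//.
  apply: (@le_trans _ _ (delta * W)); last by rewrite ler_wpM2l ?(ltW d0)// lerDl.
  rewrite mulr_sumr; apply: ler_sum => x _; rewrite Normc.normcM mulrC.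
  rewrite ler_wpM2r ?normc_ge0// tpc_cat.
  have -> : tpc [:: (0, -1)] (n - x.1) = - (n - x.1 == 0)%:R :> R[i].
    by rewrite /tpc big_cons big_nil eq_sym; case: eqP; rewrite ?addr0 ?oppr0.
  have [->|n0] := eqVneq (n - x.1) 0; first by rewrite k0 subrr Normc.normc0 ltW.
  by rewrite subr0 kd.
have [|r [rE rint]] := HC t (delta * (W + 1)) _ (fun n _ => tcoef n).
  by rewrite mulr_gt0// ltr_wpDl.
have rint' := le_trans rint dCW.
pose g z := tp (t ++ tscale (-1) r) z.
have cg : ccontinuous g by exact: ccontinuous_tp.
have gi : cintegrable (@haar R) setT g by exact: ccontinuous_cintegrable.
(* The subtracted p meets f, leaving the small error f - p, the concentrated term K p and the small
   correction r. *)
have gE z : f z + g z = (f z - tp s z) + ((K z)%:C * tp s z - tp r z).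
  by rewrite /g tp_cat tE tp_scale; ring.
have [nu nuE] := exists_add_density mu gi.
exists nu.
have ifs : cintegrable (@haar R) setT (fun z => f z - tp s z).
  apply: cintegrableB => //; apply: ccontinuous_cintegrable; exact: ccontinuous_tp.
have i1 := integrable_normc measurableT ifs.
have i2 : (@haar R).-integrable setT (EFin \o (fun z => phi z * K z)).
  by apply: integrable_continuous_circle => z; exact: cvgM (cphi z) (cK z).
have i3 : (@haar R).-integrable setT (EFin \o (fun z => nc (tp r z))).
  by apply: integrable_continuous_circle; apply: continuous_normc; exact: ccontinuous_tp.
have isK : (@haar R).-integrable setT (EFin \o (fun z => Num.sqrt (K z))).
  apply: integrable_continuous_circle => z.
  exact: (continuous_comp (cK z) (@sqrt_continuous _ _)).
have iphi : (@haar R).-integrable setT (EFin \o phi) by exact: integrable_continuous_circle.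
have ifg : cintegrable (@haar R) setT (fun z => f z + g z) by exact: cintegrableD.
have infg := integrable_normc measurableT ifg.
have fgE z : nc (f z + g z) <= nc (f z - tp s z) + (phi z * K z + nc (tp r z)).
  rewrite gE (le_trans (le_normcD _ _))// lerD2l (le_trans (le_normcD _ _))// normcN.
  by rewrite lerD2r Normc.normcM normc_real ger0_norm// mulrC.
split.
- have [mK hK] := haar_gt1_le cK K0.
  exists (S `|` [set z | 1 < K z]); split; first exact: measurableU.
    rewrite (le_trans (measureU2 _ _ _))// (le_trans (leeD hS hK))//.
    rewrite -EFinD lee_fin [leRHS]e8.
    exact: small_set eta0 (le_trans sK eta'1).
  apply: le_trans (variation_add_density_le mS fi muf _ gi nuE) _.
  (* The complement of the exceptional set misses S, so [mu] on S contributes nothing and only the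
     integral of |f + g| remains. *)
  rewrite setCU setIAC setICl set0I.
  apply: le_trans (leeD (variation_set0 mu) (lexx _)) _.
  rewrite add0e lee_fin.
  apply: (@le_trans _ _ (\int[@haar R]_z
      (nc (f z - tp s z) + (W * Num.sqrt (K z) + nc (tp r z))))).
    apply: le_Rintegral_sub => //.
    + by apply: measurableI; exact: measurableC.
    + apply: integrableD_EFin => //; apply: integrableD_EFin => //.
      exact: integrableZ_EFin.
    + by move=> z; rewrite !addr_ge0 ?mulr_ge0 ?normc_ge0 ?sqrtr_ge0.
    (* Where K <= 1 one has K <= sqrt K, hence |p| K <= W sqrt K. *)
    + move=> z [_ /= /negP]; rewrite -leNgt => K1.
      rewrite (le_trans (fgE z))// lerD2l lerD2r ler_pM//.
      rewrite -[leLHS](sqr_sqrtr (K0 z)) expr2 ler_piMr ?sqrtr_ge0//.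
      by rewrite -[leRHS]sqrtr1 ler_wsqrtr.
  rewrite RintegralD//; last first.
    by apply: integrableD_EFin => //; exact: integrableZ_EFin.
  rewrite RintegralD//; last exact: integrableZ_EFin.
  rewrite RintegralZl//.
  rewrite [leRHS]e8; apply: small_var => //.
  exact: le_trans (ler_wpM2l W0 sK) eta'W.
- apply: le_trans (variation_add_density_le mS fi muf _ gi nuE) _.
  rewrite setTI.
  (* Weighting by K raises the L^1 norm of p by at most [eta'], and that norm exceeds the one of f
     by at most the approximation error. *)
  have h1 : \int[@haar R]_z nc (f z + g z) <= \int[@haar R]_z nc (f z) + 4 * eta.
    have h2 : \int[@haar R]_z nc (f z + g z) <= \int[@haar R]_z nc (f z - tp s z) +
        (\int[@haar R]_z (phi z * K z) + \int[@haar R]_z nc (tp r z)).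
      rewrite -RintegralD// -RintegralD//; last exact: integrableD_EFin.
      apply: le_Rintegral => //.
      by apply: integrableD_EFin => //; exact: integrableD_EFin.
    have h3 : \int[@haar R]_z phi z <= \int[@haar R]_z nc (f z) +
        \int[@haar R]_z nc (f z - tp s z).
      rewrite -RintegralD//; last exact: integrable_normc.
      apply: le_Rintegral => //.
        by apply: integrableD_EFin => //; exact: integrable_normc.
      move=> z _; rewrite normc_sub -[phi z]/(nc (tp s z)).
      by rewrite -[in leLHS](subrK (f z) (tp s z)) addrC le_normcD.
    exact: norm_density eta'1 h2 phiK h3 hs rint'.
  have h4 := variation_density_le mS fi muf eta0.
  apply: (@le_trans _ _ (variation_measure mu S +
      ((\int[@haar R]_z nc (f z))%:E + (4 * eta)%:E))%E).
    by rewrite leeD2l// -EFinD lee_fin.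
  rewrite addeA (le_trans (leeD h4 (lexx _)))// -addeA leeD2l// -EFinD lee_fin.
  by rewrite [leRHS]e8 norm_total.
- move=> n Ln; rewrite /fourier_stieltjes.
  have [cr ci] := @ccontinuous_chr R (- n).
  rewrite (charge_Cintegral_density gi nuE).
  + rewrite -[cint _ _ _]/(fourier_coef g n) fourier_coef_tp tpc_cat tpc_scale rE//.
    by rewrite mulN1r subrr addr0.
  + exact: measurable_continuous_circle cr.
  + exact: measurable_continuous_circle ci.
  + by move=> z; rewrite normc_chr.
Qed.
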